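(* Let $\mathbf{T}$ be a pile of quadrangulations of a polygon such that $\varkappa=\varkappa(\mathbf{T})$ is comfortable. Then every coherent solution $\mathbf{x}=(x_s)_{s\in\varkappa^0}$ of the Kashaev equation with all components nonzero and with $x_{v_1}x_{v_3}+x_{v_2}x_{v_4}\neq0$ for every $2$-face of $\varkappa$ with vertices $v_1,v_2,v_3,v_4$ in cyclic order can be extended to an array $\tilde{\mathbf{x}}=(x_s)_{s\in\varkappa^{02}}$ satisfying the K-hexahedron equations.
   Context: A quadrangulation of a polygon $R\subset\mathbb{R}^2$ is a face-to-face tiling by quadrilaterals. A flip replaces three quadrilaterals forming a hexagon with common degree-$3$ interior vertex $w$ by the other subdivision of the hexagon into three quadrilaterals (new interior vertex $v$). A pile is a sequence $(T_0,\dots,T_\ell)$ with consecutive quadrangulations related by a flip. $\varkappa(\mathbf{T})$: start with $T_0$; for each flip add the new vertex $v$ and a $3$-cube with vertices $w,v$ and the six hexagon vertices, whose $2$-faces are the three old and three new quadrilaterals, with bottom vertex $w$ and top vertex $v$. $\varkappa^0,\varkappa^2,\varkappa^3$: vertices, $2$-faces, $3$-cubes; $\varkappa^{02}=\varkappa^0\cup\varkappa^2$. A vertex is interior if it has a neighbourhood homeomorphic to an open ball in $\mathbb{R}^3$. Comfortable: with $\sim$ the equivalence relation on $\varkappa^2$ generated by opposite faces of $3$-cubes, $\varkappa_\boxdot$ its classes, and $\psi_\varkappa(\mathbf{t})_C=t_{[a]}t_{[b]}t_{[c]}$ ($a,b,c$ representing the three pairs of opposite faces of $C$), every $\mathbf{u}\in\{-1,1\}^{\varkappa^3}$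 with $\prod_{C\ni v}u_C=1$ for all interior vertices $v$ lies in the image of $\psi_\varkappa$ (the converse always holds). For a $3$-cube $C$ with vertex values $z_{ijk}$ (cube isomorphism $C\cong\{0,1\}^3$): $K^C=2(a^2+b^2+c^2+d^2)-(a+b+c+d)^2-4(s+t)$ with $a=z_{000}z_{111}$, $b=z_{100}z_{011}$, $c=z_{010}z_{101}$, $d=z_{001}z_{110}$, $s=z_{000}z_{011}z_{101}z_{110}$, $t=z_{111}z_{100}z_{010}z_{001}$; for a vertex $v$ labeled $000$, $K^C_v=\frac12(z_{111}z_{000}^2-z_{000}(z_{100}z_{011}+z_{010}z_{101}+z_{001}z_{110}))-z_{100}z_{010}z_{001}$. A coherent solution of the Kashaev equation: $K^C(\mathbf{x})=0$ for all $3$-cubes, and for every interior vertex $v$, $\prod_{C\ni v}K^C_v(\mathbf{x})=\prod_{S\ni v}(x_vx_{v_2}+x_{v_1}x_{v_3})$ (over $3$-cubes and $2$-faces containing $v$; $v,v_1,v_2,v_3$ in cyclic order on $S$). K-hexahedron equations for $\tilde{\mathbf{x}}$ (nonzero on vertices): $x_s^2=x_{v_1}x_{v_3}+x_{v_2}x_{v_4}$ for each $2$-face $s$ (vertices in cyclic order), and for each $3$-cube, identified with $[0,1]^3$ with bottom $000$ and top $111$, with $z_{ijk}$ vertex values and $z_p$ the value at the face centered at $p$: $z_{1\frac12\frac12}=(z_{\frac120\frac12}z_{\frac12\frac120}+z_{0\frac12\frac12}z_{100})/z_{000}$, $z_{\frac121\frac12}=(z_{0\frac12\frac12}z_{\frac12\frac120}+z_{\frac120\frac12}z_{010})/z_{000}$,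 $z_{\frac12\frac121}=(z_{0\frac12\frac12}z_{\frac120\frac12}+z_{\frac12\frac120}z_{001})/z_{000}$, $z_{111}=(A+2z_{0\frac12\frac12}z_{\frac120\frac12}z_{\frac12\frac120})/z_{000}^2$, $A=2z_{100}z_{010}z_{001}+z_{000}(z_{100}z_{011}+z_{010}z_{101}+z_{001}z_{110})$. *)

(* Defs.v *)
From HB Require Import structures.
From mathcomp Require Import all_boot all_order all_algebra.
From mathcomp Require Import all_classical all_reals all_analysis.
From mathcomp Require Import complex.
From Stdlib Require Import Relations.

Set Implicit Arguments.
Unset Strict Implicit.
Unset Printing Implicit Defensive.

Import Order.TTheory GRing.Theory Num.Theory.
Import numFieldNormedType.Exports.
Local Open Scope classical_set_scope.
Local Open Scope ring_scope.

Section Plane.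
Variable R : realType.
Local Notation pt := 'rV[R]_2.

Definition seg (a b : pt) : set pt :=
  [set p | exists2 t : R, 0 <= t <= 1 & p = (1 - t) *: a + t *: b].

Definition tri (a b c : pt) : set pt :=
  [set p | exists l1 l2 l3 : R,
     [/\ 0 <= l1, 0 <= l2, 0 <= l3, l1 + l2 + l3 = 1 &
         p = l1 *: a + l2 *: b + l3 *: c]].

Definition det2 (a b c : pt) : R :=
  (b 0 0 - a 0 0) * (c 0 1 - a 0 1) - (b 0 1 - a 0 1) * (c 0 0 - a 0 0).

Definition collinear (a b c : pt) : Prop := det2 a b c = 0.

(* A polygon: the closed region bounded by a simple closed polygonal curve
   with vertices P_0, ..., P_{m-1} (m >= 3), i.e. the curve together with
   its bounded complementary component(s). *)
Definition polygon (Rg : set pt) : Prop :=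
  exists P : seq pt,
    let m := size P in
    let V k := nth 0 P (k %% m) in
    let E k := seg (V k) (V k.+1) in
    let C := \bigcup_(k in [set k : nat | (k < m)%N]) E k in
    [/\ (3 <= m)%N, uniq P,
        (forall k l, (k < m)%N -> (l < m)%N -> k <> l ->
           if (l == k.+1 %% m)%N then E k `&` E l = [set V l]
           else if (k == l.+1 %% m)%N then E k `&` E l = [set V k]
           else E k `&` E l = set0) &
        Rg = C `|` [set p | ~ C p /\ bounded_set (connected_component (~` C) p)]].

End Plane.

(* A quadrilateral with vertex labels (natural numbers) listed in cyclic
   order.  Two 4-tuples denote the same quadrilateral iff they differ by a
   dihedral symmetry (qeq). *)
Definition quad := (nat * nat * nat * nat)%type.

Definition qv0 (q : quad) : nat := q.1.1.1.
Definition qv1 (q : quad) : nat := q.1.1.2.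
Definition qv2 (q : quad) : nat := q.1.2.
Definition qv3 (q : quad) : nat := q.2.

Definition qverts (q : quad) : seq nat := [:: qv0 q; qv1 q; qv2 q; qv3 q].
Definition qedges (q : quad) : seq (nat * nat) :=
  [:: (qv0 q, qv1 q); (qv1 q, qv2 q); (qv2 q, qv3 q); (qv3 q, qv0 q)].

Definition qrot (q : quad) : quad := (qv1 q, qv2 q, qv3 q, qv0 q).
Definition qrev (q : quad) : quad := (qv3 q, qv2 q, qv1 q, qv0 q).

Definition qeq (q q' : quad) : bool :=
  q' \in [:: q; qrot q; qrot (qrot q); qrot (qrot (qrot q));
             qrev q; qrot (qrev q); qrot (qrot (qrev q));
             qrot (qrot (qrot (qrev q)))].

Definition Tverts (T : seq quad) : seq nat := flatten (map qverts T).

Section Quadrangulation.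
Variable R : realType.
Local Notation pt := 'rV[R]_2.
Variable pos : nat -> pt.

Definition simple_quad (q : quad) : Prop :=
  let a := pos (qv0 q) in let b := pos (qv1 q) in
  let c := pos (qv2 q) in let d := pos (qv3 q) in
  [/\ [/\ ~ collinear a b c, ~ collinear b c d, ~ collinear c d a &
          ~ collinear d a b], seg a b `&` seg c d = set0 &
      seg b c `&` seg d a = set0].

(* closed region bounded by a simple quadrilateral: cut along a diagonal
   lying inside it (the diagonal ac is inside iff b, d lie strictly on
   opposite sides of the line ac) *)
Definition quad_region (q : quad) : set pt :=
  let a := pos (qv0 q) in let b := pos (qv1 q) in
  let c := pos (qv2 q) in let d := pos (qv3 q) in
  if det2 a c b * det2 a c d < 0 then tri a b c `|` tri a c d
  else tri b c d `|` tri b d a.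

Definition face_to_face (q q' : quad) : Prop :=
  let X := quad_region q `&` quad_region q' in
  [\/ X = set0,
      exists2 p, (p \in qverts q) && (p \in qverts q') & X = [set pos p] |
      exists p p', [/\ (p, p') \in qedges q,
                       ((p, p') \in qedges q') || ((p', p) \in qedges q') &
                       X = seg (pos p) (pos p')]].

Definition is_quadrangulation (Rg : set pt) (T : seq quad) : Prop :=
  [/\ (forall q, q \in T -> simple_quad q),
      {in Tverts T &, injective pos},
      Rg = \bigcup_(q in [set q | q \in T]) quad_region q &
      (forall i j, (i < size T)%N -> (j < size T)%N -> i <> j ->
         let q := nth (0,0,0,0)%N T i in let q' := nth (0,0,0,0)%N T j in
         interior (quad_region q) `&` interior (quad_region q') = set0 /\
         face_to_face q q')].

End Quadrangulation.

(* A flip: old degree-3 vertex w, new vertex v, hexagon h0,...,h5 in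
   cyclic order.  Old quadrilaterals: (w,h0,h1,h2), (w,h2,h3,h4),
   (w,h4,h5,h0); new ones: (v,h1,h2,h3), (v,h3,h4,h5), (v,h5,h0,h1). *)
Record flip := Flip { fw : nat; fv : nat;
  fh0 : nat; fh1 : nat; fh2 : nat; fh3 : nat; fh4 : nat; fh5 : nat }.

Definition flip0 := Flip 0 0 0 0 0 0 0 0.

Definition old1 f : quad := (fw f, fh0 f, fh1 f, fh2 f).
Definition old2 f : quad := (fw f, fh2 f, fh3 f, fh4 f).
Definition old3 f : quad := (fw f, fh4 f, fh5 f, fh0 f).
Definition new1 f : quad := (fv f, fh1 f, fh2 f, fh3 f).
Definition new2 f : quad := (fv f, fh3 f, fh4 f, fh5 f).
Definition new3 f : quad := (fv f, fh5 f, fh0 f, fh1 f).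

Definition is_old f (q : quad) : bool :=
  [|| qeq q (old1 f), qeq q (old2 f) | qeq q (old3 f)].

Definition apply_flip (T : seq quad) (f : flip) : seq quad :=
  [seq q <- T | ~~ is_old f q] ++ [:: new1 f; new2 f; new3 f].

Definition pile_T (T0 : seq quad) (F : seq flip) (i : nat) : seq quad :=
  foldl apply_flip T0 (take i F).

Definition flip_valid (T : seq quad) (f : flip) (used : seq nat) : Prop :=
  [/\ has (qeq (old1 f)) T, has (qeq (old2 f)) T, has (qeq (old3 f)) T,
      (forall q, q \in T -> fw f \in qverts q -> is_old f q) &
      fv f \notin used].

Definition is_pile (R : realType) (pos : nat -> 'rV[R]_2) (Rg : set 'rV[R]_2)
    (T0 : seq quad) (F : seq flip) : Prop :=
  [/\ polygon Rg,
      (forall i, (i <= size F)%N -> is_quadrangulation pos Rg (pile_T T0 F i)) &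
      (forall i, (i < size F)%N ->
         flip_valid (pile_T T0 F i) (nth flip0 F i)
                    (Tverts T0 ++ map fv (take i F)))].

Definition kverts (T0 : seq quad) (F : seq flip) : seq nat :=
  Tverts T0 ++ map fv F.
Definition kfaces (T0 : seq quad) (F : seq flip) : seq quad :=
  T0 ++ flatten [seq [:: new1 f; new2 f; new3 f] | f <- F].

(* cube isomorphism {0,1}^3 -> vertices of the cube of flip f:
   000 = w (bottom), 111 = v (top) *)
Definition cvert (f : flip) (a b c : bool) : nat :=
  match a, b, c with
  | false, false, false => fw f
  | true, false, false => fh0 f
  | false, true, false => fh2 f
  | false, false, true => fh4 f
  | true, true, false => fh1 f
  | false, true, true => fh3 f
  | true, false, true => fh5 f
  | true, true, true => fv f
  end.

Definition cube_verts (f : flip) : seq nat :=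
  [:: fw f; fh0 f; fh1 f; fh2 f; fh3 f; fh4 f; fh5 f; fv f].

(* pairs of opposite 2-faces of the cube of f:
   (old2 = face x=0, new3 = face x=1), (old3 = y=0, new1 = y=1),
   (old1 = z=0, new2 = z=1) *)
Definition opp_faces (F : seq flip) (q q' : quad) : Prop :=
  exists2 i, (i < size F)%N &
    let f := nth flip0 F i in
    [|| qeq q (old2 f) && qeq q' (new3 f),
        qeq q (old3 f) && qeq q' (new1 f) |
        qeq q (old1 f) && qeq q' (new2 f)].

(* the equivalence relation ~ on 2-faces generated by opposite faces of
   3-cubes (on tuples: also identifying tuples denoting the same face) *)
Definition face_sim (F : seq flip) : relation quad :=
  clos_refl_sym_trans quad (fun q q' => qeq q q' \/ opp_faces F q q').

Section Realization.
Variable R : realType.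
Variables (T0 : seq quad) (F : seq flip).

Definition kN : nat := (\max_(v <- kverts T0 F) v).+1.

Definition evec (v : nat) : 'rV[R]_kN := \row_j (((j : nat) == v)%:R).

Definition wt (b : bool) (a : R) : R := if b then a else 1 - a.

Definition cube_pt (f : flip) (a b c : R) : 'rV[R]_kN :=
  \sum_(e : bool * bool * bool)
     (wt e.1.1 a * wt e.1.2 b * wt e.2 c) *: evec (cvert f e.1.1 e.1.2 e.2).

Definition face_pt (q : quad) (a b : R) : 'rV[R]_kN :=
  ((1 - a) * (1 - b)) *: evec (qv0 q) + (a * (1 - b)) *: evec (qv1 q)
  + (a * b) *: evec (qv2 q) + ((1 - a) * b) *: evec (qv3 q).

Definition unitI (a : R) : Prop := 0 <= a <= 1.

Definition realization : set 'rV[R]_kN :=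
  [set p | (exists q, [/\ q \in kfaces T0 F & exists a b,
                  [/\ unitI a, unitI b & p = face_pt q a b]])
        \/ (exists2 i, (i < size F)%N & exists a b c,
                  [/\ unitI a, unitI b, unitI c &
                      p = cube_pt (nth flip0 F i) a b c])].

End Realization.

Definition homeomorphic (T1 T2 : topologicalType) (A : set T1) (B : set T2)
  : Prop :=
  exists (f : T1 -> T2) (g : T2 -> T1),
    [/\ {within A, continuous f}, {within B, continuous g},
        (forall x, A x -> B (f x) /\ g (f x) = x) &
        (forall y, B y -> A (g y) /\ f (g y) = y)].

Definition open_ball3 (R : realType) : set 'rV[R]_3 :=
  [set y | \sum_(i < 3) (y 0 i) ^+ 2 < 1].

Definition interior_vertex (R : realType) (T0 : seq quad) (F : seq flip)
    (v : nat) : Prop :=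
  v \in kverts T0 F /\
  exists U : set 'rV[R]_(kN T0 F),
    [/\ U `<=` @realization R T0 F, U (@evec R T0 F v),
        (exists2 O, open O & U = O `&` @realization R T0 F) &
        homeomorphic U (@open_ball3 R)].

Definition comfortable (R : realType) (T0 : seq quad) (F : seq flip) : Prop :=
  forall u : nat -> int,
    (forall i, (i < size F)%N -> u i = 1 \/ u i = -1) ->
    (forall v, interior_vertex R T0 F v ->
       \prod_(i < size F | v \in cube_verts (nth flip0 F i)) u i = 1) ->
    exists t : quad -> int,
      [/\ (forall q, q \in kfaces T0 F -> t q = 1 \/ t q = -1),
          (forall q q', face_sim F q q' -> t q = t q') &
          (forall i, (i < size F)%N ->
             let f := nth flip0 F i in
             u i = t (old1 f) * t (old2 f) * t (old3 f))].

Section Kashaev.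
Variable K : fieldType.

Definition Kcube (z : bool -> bool -> bool -> K) : K :=
  let a := z false false false * z true true true in
  let b := z true false false * z false true true in
  let c := z false true false * z true false true in
  let d := z false false true * z true true false in
  let s := z false false false * z false true true * z true false true
           * z true true false in
  let t := z true true true * z true false false * z false true false
           * z false false true in
  2 * (a ^+ 2 + b ^+ 2 + c ^+ 2 + d ^+ 2) - (a + b + c + d) ^+ 2 - 4 * (s + t).

(* K^C_v where v has coordinates (a0,b0,c0); the cube is relabelled by the
   reflection sending v to 000 *)
Definition Kvert (z : bool -> bool -> bool -> K) (a0 b0 c0 : bool) : K :=
  let z' i j k := z (addb i a0) (addb j b0) (addb k c0) in
  2^-1 * (z' true true true * z' false false false ^+ 2
          - z' false false false * (z' true false false * z' false true true
                                   + z' false true false * z' true false true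
                                   + z' false false true * z' true true false))
  - z' true false false * z' false true false * z' false false true.

Definition zf (f : flip) (x : nat -> K) : bool -> bool -> bool -> K :=
  fun a b c => x (cvert f a b c).

Definition Kv (f : flip) (x : nat -> K) (v : nat) : K :=
  match [pick e : bool * bool * bool | cvert f e.1.1 e.1.2 e.2 == v] with
  | Some e => Kvert (zf f x) e.1.1 e.1.2 e.2
  | None => 0
  end.

(* x_{v1} x_{v3} + x_{v2} x_{v4} for a face with vertices v1..v4 in cyclic
   order (equal to x_v x_{v2} + x_{v1} x_{v3} for any vertex v of it) *)
Definition fterm (x : nat -> K) (q : quad) : K :=
  x (qv0 q) * x (qv2 q) + x (qv1 q) * x (qv3 q).

End Kashaev.

Definition coherent (R : realType) (T0 : seq quad) (F : seq flip)
    (x : nat -> R[i]) : Prop :=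
  (forall i, (i < size F)%N -> Kcube (zf (nth flip0 F i) x) = 0) /\
  (forall v, interior_vertex R T0 F v ->
     \prod_(i < size F | v \in cube_verts (nth flip0 F i))
         Kv (nth flip0 F i) x v
     = \prod_(q <- kfaces T0 F | v \in qverts q) fterm x q).

Definition K_hexahedron (K : fieldType) (T0 : seq quad) (F : seq flip)
    (x : nat -> K) (y : quad -> K) : Prop :=
  (forall q, q \in kfaces T0 F -> y q ^+ 2 = fterm x q) /\
  (forall i, (i < size F)%N ->
     let f := nth flip0 F i in
     let z := zf f x in
     (* face centres: (0,1/2,1/2) = old2, (1/2,0,1/2) = old3,
        (1/2,1/2,0) = old1, (1,1/2,1/2) = new3, (1/2,1,1/2) = new1,
        (1/2,1/2,1) = new2 *)
     let A := 2 * z true false false * z false true false * z false false true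
              + z false false false *
                (z true false false * z false true true
                 + z false true false * z true false true
                 + z false false true * z true true false) in
     [/\ y (new3 f) = (y (old3 f) * y (old1 f)
                       + y (old2 f) * z true false false) / z false false false,
         y (new1 f) = (y (old2 f) * y (old1 f)
                       + y (old3 f) * z false true false) / z false false false,
         y (new2 f) = (y (old2 f) * y (old3 f)
                       + y (old1 f) * z false false true) / z false false false &
         z true true true = (A + 2 * y (old2 f) * y (old3 f) * y (old1 f))
                            / z false false false ^+ 2]).

Arguments interior_vertex R T0 F v : clear implicits.
Arguments comfortable R T0 F : clear implicits.
Arguments coherent R T0 F x : clear implicits.

(* Main.v *)
(* Choosing square roots of the face terms on the initial quadrangulation and
   propagating them upwards, one solves the K-hexahedron equations up to a sign
   u_C in each cube C: the value at the top vertex is one of the two roots of a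
   quadratic equation, and u_C says which. With these face variables y,
     K^C_v = +/- u_C * (product of y over the three faces of C at v),
   the sign being + exactly when v is the top or the bottom of C. At an interior
   vertex every face lies in exactly two cubes, so coherence says that the u_C
   at v multiply to 1; comfortableness then gives u = psi(t), and t * y solves
   the equations.

   That every face at an interior vertex lies in two cubes is a topological
   fact, since interior vertices are defined by a homeomorphism. If it fails at
   v, there is a face at v lying in exactly one cube; close to an inner point of
   it the realization is a closed half-space. A closed half-ball minus a point p
   of its flat side is star-shaped, hence a small sphere around the image of p
   would be null-homotopic in the complement of that image, contradicting the
   Poincare-Miranda theorem in dimension 3. The latter is obtained from a
   discrete Stokes formula for the cup product of the coboundaries of three 0/1
   functions on a grid. *)
Require Import Defs.
From HB Require Import structures.
From mathcomp Require Import all_boot all_order all_algebra.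
From mathcomp Require Import all_classical all_reals all_analysis.
From mathcomp Require Import complex.
From mathcomp Require Import ring lra.

Set Implicit Arguments.
Unset Strict Implicit.
Unset Printing Implicit Defensive.

Import Order.TTheory GRing.Theory Num.Theory.
Import numFieldNormedType.Exports.
Local Open Scope classical_set_scope.
Local Open Scope ring_scope.

(** * The Poincare-Miranda theorem in dimension three *)

(** The cup product of the coboundaries of [b] and [c] on a unit square, cut along its diagonal into
    two oppositely oriented triangles. *)
Definition winding2 (R : comPzRingType) (b c : nat -> nat -> R) (y z : nat) : R :=
  (b y.+1 z - b y z) * (c y.+1 z.+1 - c y.+1 z)
  - (b y z.+1 - b y z) * (c y.+1 z.+1 - c y z.+1).

(** Discrete Stokes formula, db dc = d(b dc): only boundary edges contribute. There [c] is constant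
    for [z] = 0 and [z] = [N], [b] vanishes for [y] = 0, and for [y] = [N] the increments of [c]
    telescope to 1. *)
Lemma sum_winding2 (R : comPzRingType) (N : nat) (b c : nat -> nat -> R) :
  (forall z, b 0 z = 0) -> (forall z, b N z = 1) ->
  (forall y, c y 0 = 0) -> (forall y, c y N = 1) ->
  \sum_(0 <= y < N) \sum_(0 <= z < N) winding2 b c y z = 1.
Proof.
move=> b0 b1 c0 c1.
pose P y z := b y z * (c y z.+1 - c y z).
pose Q y z := b y z * (c y.+1 z - c y z).
have E y z : winding2 b c y z = (P y.+1 z - P y z) - (Q y z.+1 - Q y z).
  by rewrite /winding2 /P /Q; ring.
under eq_bigr => y _.
  under eq_bigr => z _ do rewrite E.
  rewrite sumrB telescope_sumr // /Q !c0 !c1 !subrr !mulr0 !subrr subr0.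
  over.
rewrite exchange_big /=.
under eq_bigr => z _.
  rewrite telescope_sumr // /P b1 b0 mul0r mul1r subr0.
  over.
by rewrite telescope_sumr // c1 c0 subr0.
Qed.

Section Cup3.
Variables (R : comPzRingType) (a b c : nat -> nat -> nat -> R).

(** The cup product of three coboundaries on the simplex with ordered vertices [u0], [u1], [u2],
    [u3]. *)
Definition step3 (u0 u1 u2 u3 : nat * nat * nat) : R :=
  (a u1.1.1 u1.1.2 u1.2 - a u0.1.1 u0.1.2 u0.2)
  * (b u2.1.1 u2.1.2 u2.2 - b u1.1.1 u1.1.2 u1.2)
  * (c u3.1.1 u3.1.2 u3.2 - c u2.1.1 u2.1.2 u2.2).

(** The six monotone edge paths across a unit cube span the simplices of its Kuhn triangulation;
    each is signed by the permutation of the axes that it follows. *)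
Definition winding3 (x y z : nat) : R :=
  let s u1 u2 := step3 (x, y, z) u1 u2 (x.+1, y.+1, z.+1) in
  s (x.+1, y, z) (x.+1, y.+1, z) - s (x.+1, y, z) (x.+1, y, z.+1)
  + s (x, y.+1, z) (x, y.+1, z.+1) - s (x, y.+1, z) (x.+1, y.+1, z)
  + s (x, y, z.+1) (x.+1, y, z.+1) - s (x, y, z.+1) (x, y.+1, z.+1).

(** Stokes again, da db dc = d(a db dc): [P], [Q], [S] are the fluxes through the squares orthogonal
    to the three axes. The boundary values kill all of them except on the side [x] = [N], which is
    the two-dimensional case. *)
Lemma sum_winding3 (N : nat) :
  (forall y z, a 0 y z = 0) -> (forall y z, a N y z = 1) ->
  (forall x z, b x 0 z = 0) -> (forall x z, b x N z = 1) ->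
  (forall x y, c x y 0 = 0) -> (forall x y, c x y N = 1) ->
  \sum_(0 <= x < N) \sum_(0 <= y < N) \sum_(0 <= z < N) winding3 x y z = 1.
Proof.
move=> a0 a1 b0 b1 c0 c1.
pose P x y z := a x y z * (b x y.+1 z - b x y z) * (c x y.+1 z.+1 - c x y.+1 z)
  - a x y z * (b x y z.+1 - b x y z) * (c x y.+1 z.+1 - c x y z.+1).
pose Q x y z := a x y z * (b x y z.+1 - b x y z) * (c x.+1 y z.+1 - c x y z.+1)
  - a x y z * (b x.+1 y z - b x y z) * (c x.+1 y z.+1 - c x.+1 y z).
pose S x y z := a x y z * (b x.+1 y z - b x y z) * (c x.+1 y.+1 z - c x.+1 y z)
  - a x y z * (b x y.+1 z - b x y z) * (c x.+1 y.+1 z - c x y.+1 z).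
have E x y z : winding3 x y z = (P x.+1 y z - P x y z) + (Q x y.+1 z - Q x y z)
    + (S x y z.+1 - S x y z).
  by rewrite /winding3 /step3 /P /Q /S /=; ring.
have Sz x y : \sum_(0 <= z < N) (S x y z.+1 - S x y z) = 0.
  by rewrite telescope_sumr // /S !c0 !c1 !subrr !mulr0 !subrr.
have Qy x : \sum_(0 <= y < N) \sum_(0 <= z < N) (Q x y.+1 z - Q x y z) = 0.
  rewrite exchange_big /= big1 // => z _.
  by rewrite telescope_sumr // /Q !b0 !b1 !subrr !mulr0 !mul0r !subrr.
under eq_bigr => x _.
  under eq_bigr => y _.
    under eq_bigr => z _ do rewrite E.
    rewrite 2!big_split /= Sz addr0.
    over.
  rewrite big_split /= Qy addr0.
  under eq_bigr => y _ do rewrite sumrB.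
  rewrite sumrB.
  over.
rewrite telescope_sumr // [X in _ - X]big1 ?subr0; last first.
  by move=> y _; rewrite big1 // => z _; rewrite /P a0 !mul0r subrr.
rewrite -(@sum_winding2 _ N (b N) (c N)) //.
apply: eq_bigr => y _; apply: eq_bigr => z _.
by rewrite /P /winding2 a1 !mul1r.
Qed.
End Cup3.

(** The cells have total winding 1, so some cell has a nonzero term [step3]. None of its three
    factors vanishes, hence each of the three functions takes both values on that cell. *)
Lemma mixed_cell (N : nat) (g : 'I_3 -> nat -> nat -> nat -> bool) :
  (forall y z, ~~ g 0 0 y z) -> (forall y z, g 0 N y z) ->
  (forall x z, ~~ g 1 x 0 z) -> (forall x z, g 1 x N z) ->
  (forall x y, ~~ g 2 x y 0) -> (forall x y, g 2 x y N) ->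
  exists x y z, [/\ (x < N)%N, (y < N)%N & (z < N)%N] /\
    forall i, exists u v : nat * nat * nat,
      g i u.1.1 u.1.2 u.2 /\ ~~ g i v.1.1 v.1.2 v.2 /\
      forall w, (w = u \/ w = v) ->
        [/\ (x <= w.1.1 <= x.+1)%N, (y <= w.1.2 <= y.+1)%N & (z <= w.2 <= z.+1)%N].
Proof.
move=> a0 a1 b0 b1 c0 c1.
pose f i x y z : int := (g i x y z)%:R.
have S : \sum_(0 <= x < N) \sum_(0 <= y < N) \sum_(0 <= z < N)
     winding3 (f 0) (f 1) (f 2) x y z = 1.
  by apply: sum_winding3 => u v; rewrite /f ?a1 ?b1 ?c1 //
    (negPf (a0 _ _), negPf (b0 _ _), negPf (c0 _ _)).
have [x [y [z [xN yN zN nz]]]] : exists x y z,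
    [/\ (x < N)%N, (y < N)%N, (z < N)%N & winding3 (f 0) (f 1) (f 2) x y z != 0].
  apply: contrapT => H; suff : (0 : int) = 1 by [].
  rewrite -S big_nat_cond big1 // => x /andP[/andP[_ xN] _].
  rewrite big_nat_cond big1 // => y /andP[/andP[_ yN] _].
  rewrite big_nat_cond big1 // => z /andP[/andP[_ zN] _].
  by apply/eqP; apply: contrapT => /negP nz; apply: H; exists x, y, z.
exists x, y, z; split => // i.
pose cell (w : nat * nat * nat) :=
  [/\ (x <= w.1.1 <= x.+1)%N, (y <= w.1.2 <= y.+1)%N & (z <= w.2 <= z.+1)%N].
have step u1 u2 : cell u1 -> cell u2 ->
    step3 (f 0) (f 1) (f 2) (x, y, z) u1 u2 (x.+1, y.+1, z.+1) != 0 ->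
    exists u v : nat * nat * nat,
      g i u.1.1 u.1.2 u.2 /\ ~~ g i v.1.1 v.1.2 v.2 /\
      forall w, (w = u \/ w = v) -> cell w.
  move=> c1' c2'.
  have cx : cell (x, y, z) by split; rewrite /= leqnn leqnSn.
  have cX : cell (x.+1, y.+1, z.+1) by split; rewrite /= leqnn leqnSn.
  have mix u v : cell u -> cell v -> f i v.1.1 v.1.2 v.2 - f i u.1.1 u.1.2 u.2 != 0 ->
      exists u v : nat * nat * nat,
      g i u.1.1 u.1.2 u.2 /\ ~~ g i v.1.1 v.1.2 v.2 /\
      forall w, (w = u \/ w = v) -> cell w.
    move=> cu cv; rewrite /f.
    case gu : (g i u.1.1 u.1.2 u.2); case gv : (g i v.1.1 v.1.2 v.2) => //= _.
      by exists u, v; rewrite gu gv; do !split => //; case: H => ->; case: cu; case: cv.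
    by exists v, u; rewrite gu gv; do !split => //; case: H => ->; case: cu; case: cv.
  rewrite /step3 !mulf_eq0 !negb_or => /andP[/andP[H0 H1] H2].
  case: i mix => -[|[|[|//]]] ? mix.
  - by apply: (mix (x, y, z) u1) => //; move: H0; rewrite (_ : Ordinal _ = 0) //; apply: val_inj.
  - by apply: (mix u1 u2) => //; move: H1; rewrite (_ : Ordinal _ = 1) //; apply: val_inj.
  - by apply: (mix u2 (x.+1, y.+1, z.+1)) => //; move: H2; rewrite (_ : Ordinal _ = 2) //; apply: val_inj.
apply: contrapT => H; move/negP: nz; apply; rewrite /winding3.
have Z u1 u2 : cell u1 -> cell u2 ->
    step3 (f 0) (f 1) (f 2) (x, y, z) u1 u2 (x.+1, y.+1, z.+1) = 0.
  by move=> h1 h2; apply/eqP; apply: contrapT => /negP /step - /(_ h1 h2).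
by rewrite !Z ?addr0 ?subr0 //; split; rewrite /= ?leqnn ?leqnSn.
Qed.

(** * From grids to the unit cube by compactness *)

Section Miranda.
Variable R : realType.

Definition pt3 (a b c : R) : 'rV[R]_3 := \row_j nth 0 [:: a; b; c] j.

Definition unit_cube : set 'rV[R]_3 := [set x | forall i, 0 <= x 0 i <= 1].

Lemma rV_ballP (n : nat) (x y : 'rV[R]_n) (e : R) :
  ball x e y <-> 0 < e /\ forall i, `|x 0 i - y 0 i| < e.
Proof.
split=> [[e0 H]|[e0 H]]; split => //; first by move=> i; exact: H.
by move=> i j; rewrite ord1; exact: H.
Qed.

Lemma compact_unit_cube : compact unit_cube.
Proof.
have := @rV_compact R 3 (fun=> `[0, 1]%classic) (fun=> @segment_compact R 0 1).
suff -> : unit_cube = [set v : 'rV[R]_3 | forall i, `[0, 1]%classic (v ord0 i)] by [].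
by apply/seteqP; split => x /= H i; have := H i; rewrite in_itv.
Qed.

(** The factor [s] is meant to be 1 or -1, so that positive and negative coordinates are treated at
    once. *)
Lemma within_coord_pos (n m : nat) (A : set 'rV[R]_n) (G : 'rV[R]_n -> 'rV[R]_m)
    (x : 'rV[R]_n) (i : 'I_m) (s : R) :
  {within A, continuous G} -> A x -> 0 < s * G x 0 i ->
  exists2 e : R, 0 < e & forall y, A y -> (forall j, `|x 0 j - y 0 j| < e) ->
    0 < s * G y 0 i.
Proof.
move=> /subspace_continuousP Gc Ax pos.
have C : (fun y => s * G y 0 i) @ within A (nbhs x) --> s * G x 0 i.
  apply: cvgM; first exact: cvg_cst.
  apply: (@continuous_cvg _ _ _ _ _ _ (fun M : 'rV[R]_m => M 0 i)); last exact: Gc.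
  exact: coord_continuous.
have Fx : Filter (within A (nbhs x)) by exact: within_filter.
have := @cvgr_gt _ _ _ Fx _ _ C 0 pos.
rewrite near_withinE => /nbhs_ballP [e /= e0 H].
exists e => // y Ay near_xy; apply: H => //.
by apply/rV_ballP.
Qed.

(** The vertices of ever finer grids are coloured by the signs of the coordinates of [G]. By
    compactness mixed cells accumulate at some point, where no coordinate of [G] can be nonzero. *)
Lemma poincare_miranda3 (G : 'rV[R]_3 -> 'rV[R]_3) :
  {within unit_cube, continuous G} ->
  (forall x i, unit_cube x -> x 0 i = 0 -> G x 0 i <= 0) ->
  (forall x i, unit_cube x -> x 0 i = 1 -> 0 < G x 0 i) ->
  exists2 x, unit_cube x & G x = 0.
Proof.
move=> Gc G0 G1.
pose P (N x y z : nat) := pt3 (x%:R / N%:R) (y%:R / N%:R) (z%:R / N%:R).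
have in01 (N x : nat) : (0 < N)%N -> (x <= N)%N -> 0 <= (x%:R / N%:R : R) <= 1.
  move=> N0 xN; rewrite divr_ge0 ?ler0n //= ler_pdivrMr ?ltr0n // mul1r.
  by rewrite ler_nat.
have PA N x y z : (0 < N)%N -> (x <= N)%N -> (y <= N)%N -> (z <= N)%N ->
    unit_cube (P N x y z).
  move=> N0 xN yN zN -[[|[|[|//]]] ?]; rewrite mxE /=; exact: in01.
have cells n : exists c : 'rV[R]_3, unit_cube c /\ forall i, exists u v : 'rV[R]_3,
    [/\ unit_cube u, unit_cube v, 0 < G u 0 i, G v 0 i <= 0 &
      forall j, `|c 0 j - u 0 j| <= n.+1%:R^-1 /\ `|c 0 j - v 0 j| <= n.+1%:R^-1].
  pose N := n.+1.
  (* [mixed_cell] asks for boundary values at all natural indices, so indices are clamped to the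
     grid. *)
  pose cut k := minn k N.
  pose g i x y z := 0 < G (P N (cut x) (cut y) (cut z)) 0 i.
  have PAc x y z : unit_cube (P N (cut x) (cut y) (cut z)).
    by apply: PA => //; rewrite geq_minr.
  have c0 : cut 0 = 0%N by rewrite /cut min0n.
  have cN : cut N = N by rewrite /cut minnn.
  have N1 : N%:R / N%:R = 1 :> R by rewrite divff // pnatr_eq0.
  have := @mixed_cell N g.
  case; try (by move=> u v; rewrite /g -?leNgt; (apply: G0 || apply: G1);
    rewrite ?PAc // mxE /= ?c0 ?cN ?mul0r).
  move=> x [y [z [[xN yN zN] H]]].
  exists (P N (cut x) (cut y) (cut z)); split => // i.
  have [u [v [gu [gv C]]]] := H i.
  exists (P N (cut u.1.1) (cut u.1.2) (cut u.2)),
    (P N (cut v.1.1) (cut v.1.2) (cut v.2)); split => //.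
    by rewrite leNgt.
  have D (k w : nat) : (k < N)%N -> (k <= w <= k.+1)%N ->
      `|(cut k)%:R / N%:R - (cut w)%:R / N%:R| <= N%:R^-1 :> R.
    move=> kN /andP[kw wk].
    have -> : cut k = k by apply/minn_idPl; exact: ltnW.
    have -> : cut w = w by apply/minn_idPl; exact: leq_trans wk kN.
    rewrite -mulrBl normrM [`|N%:R^-1|]ger0_norm ?invr_ge0 ?ler0n //.
    rewrite ler_piMl ?invr_ge0 ?ler0n // distrC ger0_norm ?subr_ge0 ?ler_nat //.
    by rewrite lerBlDr nat1r ler_nat.
  have [Cu1 Cu2 Cu3] := C u (or_introl erefl).
  have [Cv1 Cv2 Cv3] := C v (or_intror erefl).
  by move=> [[|[|[|//]]] ?]; rewrite !mxE /=; split; apply: D.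
pose c n := projT1 (cid (cells n)).
have cA n : unit_cube (c n) by rewrite /c; case: (cid _) => ? [].
have cP n i : exists u v : 'rV[R]_3,
    [/\ unit_cube u, unit_cube v, 0 < G u 0 i, G v 0 i <= 0 &
      forall j, `|c n 0 j - u 0 j| <= n.+1%:R^-1 /\ `|c n 0 j - v 0 j| <= n.+1%:R^-1].
  by rewrite /c; case: (cid _) => ? /= [_]; apply.
have [|p [pA clp]] := @compact_unit_cube (c @ \oo) _.
  by exists 0%N => // n _; exact: cA.
exists p => //; apply/rowP => i; rewrite mxE; apply/eqP; apply: contrapT => /negP nz.
(* Near [p] this coordinate of [G] keeps its strict sign, yet cells close to [p] have one vertex
   where it is positive and one where it is not. *)
have [s [s0 spos]] : exists s : R, (s = 1 \/ s = -1) /\ 0 < s * G p 0 i.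
  case: (ltrgt0P (G p 0 i)) nz => // h _; first by exists 1; rewrite mul1r; split => //; left.
  by exists (-1); rewrite mulN1r oppr_gt0; split => //; right.
have [e e0 He] := within_coord_pos Gc pA spos.
have e20 : 0 < e / 2 by rewrite divr_gt0.
have [] := clp [set c n | n in [set n | n.+1%:R^-1 < e / 2]] (ball p (e / 2)).
- have : \forall n \near \oo, n.+1%:R^-1 < e / 2.
    exact: (near_infty_natSinv_lt (PosNum e20)).
  by move=> [m _ Hm]; exists m => // n /= mn; exists n => //; exact: Hm.
- exact: nbhsx_ballx.
move=> _ [[n /= ne <-] /rV_ballP [_ near_p]].
have [u [v [uA vA gu gv uv]]] := cP n i.
have close (w : 'rV[R]_3) : (forall j, `|c n 0 j - w 0 j| <= n.+1%:R^-1) ->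
    forall j, `|p 0 j - w 0 j| < e.
  move=> Hw j; rewrite (splitr e) -(subrKA (c n 0 j)).
  apply: le_lt_trans (ler_normD _ _) _; apply: ltrD; first exact: near_p.
  exact: le_lt_trans (Hw j) ne.
have := He u uA (@close u (fun j => proj1 (uv j))).
have := He v vA (@close v (fun j => proj2 (uv j))).
case: s0 => ->; rewrite ?mul1r ?mulN1r ?oppr_gt0 => h1 h2.
- by move: h1; rewrite ltNge gv.
- by move: h2; rewrite ltNge (ltW gu).
Qed.
End Miranda.

(** * A half-space is not locally a ball *)

Lemma cvg_withinP (S T : topologicalType) (F : set_system S) {FF : Filter F}
    (f : S -> T) (a : T) (U : set T) :
  f @ F --> a -> (\forall x \near F, U (f x)) -> f @ F --> within U (nbhs a).
Proof.
move=> fa fU W /=; rewrite /within /= => nW.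
by apply: filterS2 (fa _ nW) fU => x /=; apply.
Qed.

Lemma continuous_coords (T : topologicalType) (R : realType) (n : nat)
    (F : set_system T) {FF : Filter F} (f : T -> 'rV[R]_n) (a : 'rV[R]_n) :
  (forall j, (fun x => f x 0 j) @ F --> a 0 j) -> f @ F --> a.
Proof.
move=> H; apply/cvg_ballP => e e0.
have : \forall x \near F, forall j, j \in enum 'I_n -> `|a 0 j - f x 0 j| < e.
  elim: (enum 'I_n) => [|j s IH]; first by apply: nearW.
  have /cvg_ballP/(_ e e0) Hj := H j.
  apply: filterS2 Hj IH => x hj hs i; rewrite inE => /orP[/eqP->//|]; exact: hs.
apply: filterS => x Hx; apply/rV_ballP; split => // j; apply: Hx.
by rewrite mem_enum.
Qed.

Section HalfSpace.
Variable R : realType.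

Lemma open_open_ball3 (y : 'rV[R]_3) : open_ball3 y -> nbhs y (@open_ball3 R).
Proof.
move=> By.
have C : (fun y : 'rV[R]_3 => \sum_(i < 3) (y 0 i) ^+ 2) @ y --> \sum_(i < 3) (y 0 i) ^+ 2.
  rewrite !big_ord_recl big_ord0.
  under eq_fun do rewrite !big_ord_recl big_ord0.
  have c i : (fun y : 'rV[R]_3 => y 0 i ^+ 2) @ y --> y 0 i ^+ 2.
    have cc : (fun z : 'rV[R]_3 => z 0 i) @ y --> y 0 i by exact: coord_continuous.
    exact: (cvgM cc cc).
  exact: (cvgD (c _) (cvgD (c _) (cvgD (c _) (cvg_cst (0 : R))))).
exact: (@cvgr_lt _ _ _ _ _ _ C 1 By).
Qed.

(** Zero on the boundary of the unit cube and positive inside: the time parameter of a homotopy that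
    is fixed on the boundary. *)
Definition box_weight (x : 'rV[R]_3) : R := \prod_(i < 3) (x 0 i * (1 - x 0 i)).

Lemma box_weight_ge0_le1 (x : 'rV[R]_3) : unit_cube x -> 0 <= box_weight x <= 1.
Proof.
move=> xA; have H i : 0 <= x 0 i * (1 - x 0 i) <= 1.
  by have := xA i => /andP[h0 h1]; apply/andP; split; nra.
apply/andP; split; first by apply: prodr_ge0 => i _; case/andP: (H i).
by apply: prodr_ile1 => i _; exact: H.
Qed.

Lemma box_weight_eq0 (x : 'rV[R]_3) (i : 'I_3) : x 0 i = 0 \/ x 0 i = 1 -> box_weight x = 0.
Proof.
by rewrite /box_weight (bigD1 i) //= => -[]->; rewrite ?subrr ?mul0r ?mulr0 ?mul0r.
Qed.

Lemma continuous_box_weight : continuous box_weight.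
Proof.
suff H (x : 'rV[R]_3) : box_weight @ x --> box_weight x by [].
rewrite /box_weight.
have c i : (fun x : 'rV[R]_3 => x 0 i * (1 - x 0 i)) @ x --> x 0 i * (1 - x 0 i).
  have cc : (fun z : 'rV[R]_3 => z 0 i) @ x --> x 0 i by exact: coord_continuous.
  exact: (cvgM cc (cvgB (cvg_cst (1 : R)) cc)).
have E y : \prod_(i < 3) (y 0 i * (1 - y 0 i)) =
    (y 0 0 * (1 - y 0 0)) * ((y 0 1 * (1 - y 0 1)) * (y 0 2 * (1 - y 0 2))) :> R.
  rewrite !big_ord_recl big_ord0 mulr1; congr (_ * (_ * _));
    congr (y 0 _ * (1 - y 0 _)); exact: val_inj.
rewrite E; under eq_fun do rewrite E.
exact: (cvgM (c _) (cvgM (c _) (c _))).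
Qed.

(* A half-ball minus a point of its flat face is star-shaped, so a homeomorphism
   with the open ball would give a null-homotopy of a small sphere around the
   image of that point, against Poincare-Miranda. *)
Lemma half_space_not_ball (n : nat) (X U : set 'rV[R]_n)
    (phi : 'rV[R]_3 -> 'rV[R]_n) (chi : 'rV[R]_n -> 'rV[R]_3)
    (k : 'I_3) (s0 : 'rV[R]_3) :
  continuous phi -> continuous chi -> cancel phi chi ->
  (exists2 O, open O & U = O `&` X) -> U (phi s0) -> s0 0 k = 0 ->
  (\forall s \near s0, 0 <= (s : 'rV[R]_3) 0 k -> X (phi s)) ->
  (\forall P \near phi s0, X P -> exists2 s : 'rV[R]_3, 0 <= s 0 k & P = phi s) ->
  ~ homeomorphic U (@open_ball3 R).
Proof.
move=> phic chic phiK [V Vo UE] Up s0k nX nP [h [g [hc gc hP gP]]].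
set p := phi s0; rewrite -/p in Up nP; pose y0 := h p.
have [By0 gy0] := hP _ Up; rewrite -/y0 in By0 gy0.
have [rho rho0 Hrho] : exists2 rho : R, 0 < rho & forall s : 'rV[R]_3,
    ball s0 rho s -> 0 <= s 0 k -> U (phi s).
  have Vp : nbhs p V by apply: open_nbhs_nbhs; split => //; move: Up; rewrite UE => -[].
  have [e /= e0 He] : nbhs_ball s0 [set s | V (phi s) /\ (0 <= s 0 k -> X (phi s))].
    by apply/nbhs_ballP; apply: filterI => //; exact: (phic s0 _ Vp).
  by exists e => // s /He[h1 h2] /h2 h3; rewrite UE.
(* The centre of the contraction: [s0] pushed into the half-space, still inside the ball of radius
   [rho]. *)
pose c : 'rV[R]_3 := \row_j (s0 0 j + if j == k then rho / 2 else 0).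
(* Within this radius of [y0] the map [g] stays in the half-ball covered by the chart [phi]. *)
have [e e0 He] : exists2 e : R, 0 < e & forall y, ball y0 e y ->
    [/\ open_ball3 y, ball s0 rho (chi (g y)), 0 <= chi (g y) 0 k &
        phi (chi (g y)) = g y].
  have Q : nbhs p [set P | ball s0 rho (chi P) /\
      (X P -> exists2 s : 'rV[R]_3, 0 <= s 0 k & P = phi s)].
    apply: filterI => //; apply: (chic p).
    by rewrite /p phiK; exact: nbhsx_ballx.
  have gcy : g @ within (@open_ball3 R) (nbhs y0) --> p.
    by rewrite -gy0; move/subspace_continuousP : gc; apply.
  have := gcy _ Q; rewrite /= /within /= => H.
  have [e /= e0 He] := (nbhs_ballP _ _).1 (filterI (open_open_ball3 By0) H).
  exists e => // y /He [By /(_ By) [h1 h2]].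
  have [Ugy _] := gP _ By.
  have [|s sk gs] := h2; first by move: Ugy; rewrite UE => -[].
  by rewrite gs phiK -gs; split => //; rewrite gs phiK in h1.
pose r := e / 2; have r0 : 0 < r by rewrite /r divr_gt0.
(* Carries the unit cube to the cube with centre [y0] and half-side [r]. *)
pose aff (x : 'rV[R]_3) : 'rV[R]_3 := \row_i (y0 0 i + r * (2 * x 0 i - 1)).
have affc : continuous aff.
  suff H (x : 'rV[R]_3) : aff @ x --> aff x by [].
  apply: (@continuous_coords _ _ _ (nbhs x) _) => j; rewrite mxE; under eq_fun do rewrite mxE.
  have cc : (fun z : 'rV[R]_3 => z 0 j) @ x --> x 0 j by exact: coord_continuous.
  exact: (cvgD (cvg_cst _) (cvgM (cvg_cst _) (cvgB (cvgM (cvg_cst _) cc) (cvg_cst _)))).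
have affB x : unit_cube x -> ball y0 e (aff x).
  move=> xA; apply/rV_ballP; split => // i; rewrite mxE.
  have /andP[x0 x1] := xA i.
  by rewrite ltr_norml; apply/andP; split; rewrite /r; nra.
pose sg x := chi (g (aff x)).
pose t := box_weight.
(* The small cube read in the chart and pulled towards [c], except on its boundary, where [h]
   recovers [aff]. Convexity of the half-ball keeps it in the domain. *)
pose m x : 'rV[R]_3 := (1 - t x) *: sg x + t x *: c.
have mE x i : m x 0 i = (1 - t x) * sg x 0 i + t x * c 0 i.
  by rewrite /m mxE [X in X + _]mxE [X in _ + X]mxE.
have ck : c 0 k = rho / 2 by rewrite mxE s0k eqxx add0r.
have mB x : unit_cube x -> ball s0 rho (m x) /\ 0 <= m x 0 k.
  move=> xA; have [_ /rV_ballP[_ sB] sk _] := He _ (affB _ xA).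
  have /andP[t0 t1] := box_weight_ge0_le1 xA.
  split; last first.
    rewrite mE ck.
    apply: addr_ge0; apply: mulr_ge0 => //; first by rewrite subr_ge0.
    by rewrite divr_ge0 // ltW.
  apply/rV_ballP; split => // i; have := sB i.
  have : `|s0 0 i - c 0 i| < rho.
    rewrite mxE opprD addrA subrr add0r normrN.
    by case: ifP => _; rewrite ?normr0 // gtr0_norm ?divr_gt0 //; lra.
  rewrite mE -/(sg x).
  move: (s0 0 i) (c 0 i) (sg x 0 i) => a b d.
  rewrite !ltr_norml => /andP[b1 b2] /andP[d1 d2].
  rewrite -/t in t0 t1; move: (t x) t0 t1 => u u0 u1.
  have [->|u1'] := eqVneq u 1; first by apply/andP; split; lra.
  have {u1' u1} u1 : 0 < 1 - u by rewrite subr_gt0 lt_neqAle u1'.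
  have h1 : 0 < (1 - u) * (rho - (a - d)) by apply: mulr_gt0 => //; lra.
  have h2 : 0 < (1 - u) * (rho + (a - d)) by apply: mulr_gt0 => //; lra.
  have h3 : 0 <= u * (rho - (a - b)) by apply: mulr_ge0 => //; lra.
  have h4 : 0 <= u * (rho + (a - b)) by apply: mulr_ge0 => //; lra.
  by apply/andP; split; nra.
have mU x : unit_cube x -> U (phi (m x)) by move=> /mB[]; exact: Hrho.
have m_edge x i : unit_cube x -> x 0 i = 0 \/ x 0 i = 1 -> h (phi (m x)) = aff x.
  move=> xA xi; rewrite /m /t (box_weight_eq0 xi) subr0 scale1r scale0r addr0.
  by have [By _ _ E] := He _ (affB _ xA); rewrite /sg E; case: (gP _ By).
pose G x := h (phi (m x)) - y0.
have Gc : {within (@unit_cube R), continuous G}.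
  apply/subspace_continuousP => x xA.
  have FF : Filter (within (@unit_cube R) (nbhs x)) by exact: within_filter.
  have wx : within (@unit_cube R) (nbhs x) --> x by exact: cvg_within.
  apply: cvgB; last exact: cvg_cst.
  have nearA : \forall x \near within (@unit_cube R) (nbhs x), unit_cube x.
    exact: withinT.
  have sgc : sg @ within (@unit_cube R) (nbhs x) --> sg x.
    apply: (continuous_cvg _ (chic _)).
    have [Bx _ _ _] := He _ (affB _ xA).
    have ga : g @ within (@open_ball3 R) (nbhs (aff x)) --> g (aff x).
      by move/subspace_continuousP : gc; apply.
    apply: (cvg_comp _ _ _ ga).
    apply: cvg_withinP.
      exact: (cvg_comp _ _ wx (affc x)).
    by apply: filterS nearA => z zA; case: (He _ (affB _ zA)).
  have tc : t @ within (@unit_cube R) (nbhs x) --> t x.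
    exact: (cvg_comp _ _ wx (@continuous_box_weight x)).
  have mc : m @ within (@unit_cube R) (nbhs x) --> m x.
    apply: cvgD; apply: cvgZ => //; last exact: cvg_cst.
    by apply: cvgB => //; exact: cvg_cst.
  have ha : h @ within U (nbhs (phi (m x))) --> h (phi (m x)).
    by move/subspace_continuousP : hc; apply; exact: mU.
  apply: (cvg_comp _ _ _ ha).
  apply: cvg_withinP; first exact: (cvg_comp _ _ mc (phic _)).
  by apply: filterS nearA => z /mU.
(* On two opposite sides of the unit cube the matching coordinate of [G] is -[r] and [r]. *)
have [x i xA xi|x i xA xi|x xA Gx] := poincare_miranda3 Gc.
- rewrite /G (m_edge _ i) //; last by left.
  by rewrite !mxE xi; lra.
- rewrite /G (m_edge _ i) //; last by right.
  by rewrite !mxE xi; lra.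
have ms0 : m x = s0.
  have E : h (phi (m x)) = y0 by apply/eqP; rewrite -subr_eq0 -/(G x) Gx.
  have [_ gE] := hP _ (mU _ xA); rewrite E gy0 in gE.
  by rewrite -[LHS]phiK -gE phiK.
have [By _ sk sE] := He _ (affB _ xA).
have /andP[t0 t1] := box_weight_ge0_le1 xA; rewrite -/t in t0 t1.
(* Coordinate [k] of [m x] vanishes and is a sum of nonnegative terms, the second being [t x] times
   a positive number. So [x] has weight 0; but then [aff x] = [y0], and [x] is the centre of the
   cube, where the weight is positive. *)
have tx0 : t x = 0.
  have := congr1 (fun v : 'rV[R]_3 => v 0 k) ms0.
  rewrite mE ck s0k => mk.
  have : 0 <= (1 - t x) * sg x 0 k by apply: mulr_ge0 => //; rewrite subr_ge0.
  nra.
have sgs0 : sg x = s0 by rewrite -ms0 /m tx0 subr0 scale1r scale0r addr0.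
have affy : aff x = y0.
  by have [_ <-] := gP _ By; rewrite -sE -/(sg x) sgs0.
move: tx0; apply/eqP; rewrite /t /box_weight; apply/prodf_neq0 => i _.
have := congr1 (fun v : 'rV[R]_3 => v 0 i) affy; rewrite mxE => xi.
have -> : x 0 i = 2^-1 by nra.
by rewrite mulf_neq0 // ?invr_neq0 // ?gt_eqF //; lra.
Qed.
End HalfSpace.

(** * Quadrilaterals up to dihedral symmetry *)

Lemma qeq_refl q : qeq q q.
Proof. by rewrite /qeq inE eqxx. Qed.

Ltac qeq_cases H :=
  move: H; rewrite /qeq !inE; do ![case/orP]; move/eqP;
  rewrite ?/qrot ?/qrev ?/qv0 ?/qv1 ?/qv2 ?/qv3 /=.

Lemma qeq_sym q q' : qeq q q' -> qeq q' q.
Proof.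
case: q => [[[a b] c] d] H; qeq_cases H => ->;
  by rewrite /qeq /qrot /qrev /qv0 /qv1 /qv2 /qv3 ?inE ?eqxx ?orbT.
Qed.

Lemma qeq_trans q1 q2 q3 : qeq q1 q2 -> qeq q2 q3 -> qeq q1 q3.
Proof.
case: q1 => [[[a b] c] d] H1 H2; move: H2; qeq_cases H1 => ->; do ![case/orP]; move/eqP => ->;
  by rewrite /qeq /qrot /qrev /qv0 /qv1 /qv2 /qv3 ?inE ?eqxx ?orbT.
Qed.

Lemma qeq_perm q q' : qeq q q' -> perm_eq (qverts q) (qverts q').
Proof.
have rotP p : perm_eq (qverts p) (qverts (qrot p)).
  by rewrite perm_sym; exact: (permEl (perm_rot 1 (qverts p))).
have revP p : perm_eq (qverts p) (qverts (qrev p)).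
  by rewrite perm_sym; exact: (permEl (perm_rev (qverts p))).
rewrite /qeq !inE; do ![case/orP]; move/eqP => ->; do ?[exact: perm_refl];
 do ?(apply: perm_trans (rotP _)); by [|exact: revP].
Qed.

Lemma qeq_mem q q' : qeq q q' -> qverts q =i qverts q'.
Proof. by move/qeq_perm/perm_mem. Qed.

Lemma qeq_uniq q q' : qeq q q' -> uniq (qverts q) = uniq (qverts q').
Proof. by move/qeq_perm/perm_uniq. Qed.

(* On the bilinear patch of a quadrilateral, the two products of opposite
   weights agree; the strict inequalities prevent another cyclic order of the
   same four vertices from having this property. *)
Lemma qeq_of_weights (R : realDomainType) (w : nat -> R) (q q' : quad) :
  uniq (qverts q) -> uniq (qverts q') ->
  {subset qverts q <= qverts q'} ->
  0 < w (qv2 q) -> w (qv2 q) < w (qv1 q) -> w (qv2 q) < w (qv3 q) ->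
  w (qv1 q) < w (qv0 q) -> w (qv3 q) < w (qv0 q) ->
  w (qv0 q') * w (qv2 q') = w (qv1 q') * w (qv3 q') -> qeq q q'.
Proof.
move=> u u' s; have [_ E] := uniq_min_size u s (leqnn 4).
have s' : {subset qverts q' <= qverts q} by move=> x; rewrite E.
clear s E.
case: q u s' => [[[a b] c] d]; case: q' u' => [[[a' b'] c'] d'].
rewrite /qeq /qrot /qrev /qverts /qv0 /qv1 /qv2 /qv3 /= => u' u s'.
have A := s' a' ltac:(by rewrite !inE eqxx ?orbT).
have B := s' b' ltac:(by rewrite !inE eqxx ?orbT).
have C := s' c' ltac:(by rewrite !inE eqxx ?orbT).
have D := s' d' ltac:(by rewrite !inE eqxx ?orbT).
clear s'.
move: A B C D u u'; rewrite !inE.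
(* A non-dihedral order makes [a] opposite to [b] or to [d]. The product of the weights of that pair
   exceeds the product of the other two, against the last hypothesis. *)
do 4!(case/or4P => /eqP ->); rewrite ?eqxx ?orbT ?andbF //= => _ _ *; try done; exfalso; nra.
Qed.

(** * The realization near an inner point of a free face *)

Definition cube_faces (f : flip) : seq quad :=
  [:: old1 f; old2 f; old3 f; new1 f; new2 f; new3 f].

Lemma near_all_seq (T : eqType) (S : topologicalType) (p : S) (s : seq T)
    (A : T -> S -> Prop) :
  (forall x, x \in s -> \forall P \near p, A x P) ->
  \forall P \near p, forall x, x \in s -> A x P.
Proof.
elim: s => [|y s IH] H; first by apply: nearW.
have h1 := H y ltac:(by rewrite inE eqxx).
have h2 := IH (fun x xs => H x ltac:(by rewrite inE xs orbT)).
by apply: filterS2 h1 h2 => P h1 h2 x; rewrite inE => /orP[/eqP->|/h2].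
Qed.

(** Applied to the finitely many closed cells: close to [p] only cells through [p] are met. *)
Lemma near_closed (S : topologicalType) (C : set S) (p : S) :
  closed C -> \forall P \near p, C P -> C p.
Proof.
move=> cC; have [Cp|nCp] := pselect (C p); first by apply: nearW.
have : nbhs p (~` C) by apply: open_nbhs_nbhs; split => //; exact: closed_openC.
by apply: filterS.
Qed.

(* The quadrilateral face of the cube of [f] on which coordinate [k] is constant,
   listed from the corner [e]. *)
Definition corner_quad (f : flip) (e : 'I_3 -> bool) (k : 'I_3) : quad :=
  let c a b d := cvert f (a (+) e 0) (b (+) e 1) (d (+) e 2) in
  match val k with
  | 0 => (c false false false, c false true false, c false true true, c false false true)
  | 1 => (c false false false, c true false false, c true false true, c false false true)
  | _ => (c false false false, c true false false, c true true false, c false true false)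
  end%N.

Definition corner (e1 e2 e3 : bool) : 'I_3 -> bool := fun j => nth false [:: e1; e2; e3] j.

Ltac solve_corner H e1 e2 e3 k :=
  solve [apply: (H (corner e1 e2 e3) k); [reflexivity |
    rewrite /qeq !inE;
    repeat first [solve [apply/eqP; reflexivity]
      | apply/orP; first [solve [left; apply/eqP; reflexivity] | right]]]].

(** Standard position for a face and a vertex on it: checked for each of the 24 pairs in a cube. *)
Lemma cube_face_corner (f : flip) (o : quad) (v : nat) :
  o \in cube_faces f -> v \in qverts o ->
  exists (e : 'I_3 -> bool) k, v = cvert f (e 0) (e 1) (e 2) /\ qeq (corner_quad f e k) o.
Proof.
have H (e : 'I_3 -> bool) k : v = cvert f (e 0) (e 1) (e 2) -> qeq (corner_quad f e k) o ->
  exists (e : 'I_3 -> bool) k, v = cvert f (e 0) (e 1) (e 2) /\ qeq (corner_quad f e k) o.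
  by move=> h1 h2; exists e, k.
rewrite /cube_faces !inE => of_ vo.
have [e [k [h1 h2]]] : exists (e : 'I_3 -> bool) k,
    v = cvert f (e 0) (e 1) (e 2) /\ qeq (corner_quad f e k) o.
  do ![case/orP: of_ => of_]; move/eqP: of_ vo H => ->;
  do ![case/orP]; move/eqP => -> H;
  first [solve_corner H false false false (0 : 'I_3)
   | solve_corner H false false false (1 : 'I_3)
   | solve_corner H false false false (2 : 'I_3)
   | solve_corner H false false true (0 : 'I_3)
   | solve_corner H false false true (1 : 'I_3)
   | solve_corner H false false true (2 : 'I_3)
   | solve_corner H false true false (0 : 'I_3)
   | solve_corner H false true false (1 : 'I_3)
   | solve_corner H false true false (2 : 'I_3)
   | solve_corner H false true true (0 : 'I_3)
   | solve_corner H false true true (1 : 'I_3)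
   | solve_corner H false true true (2 : 'I_3)
   | solve_corner H true false false (0 : 'I_3)
   | solve_corner H true false false (1 : 'I_3)
   | solve_corner H true false false (2 : 'I_3)
   | solve_corner H true false true (0 : 'I_3)
   | solve_corner H true false true (1 : 'I_3)
   | solve_corner H true false true (2 : 'I_3)
   | solve_corner H true true false (0 : 'I_3)
   | solve_corner H true true false (1 : 'I_3)
   | solve_corner H true true false (2 : 'I_3)
   | solve_corner H true true true (0 : 'I_3)
   | solve_corner H true true true (1 : 'I_3)
   | solve_corner H true true true (2 : 'I_3)].
by exists e, k.
Qed.

Lemma sum_bool3 (V : nmodType) (F : bool * bool * bool -> V) :
  \sum_e F e = \sum_a \sum_b \sum_c F (a, b, c).
Proof. by rewrite pair_bigA pair_bigA /=; apply: eq_bigr => -[[a b] c]. Qed.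

(** * Closed cells of the realization and the weights of their points *)

Section Cells.
Variables (R : realType) (T0 : seq quad) (F : seq flip).
Local Notation V := 'rV[R]_(kN T0 F).
Local Notation fpt := (@face_pt R T0 F).
Local Notation cpt := (@cube_pt R T0 F).
Local Notation ev := (@evec R T0 F).

Definition face_cell (q : quad) : set V :=
  [set P | exists a b, [/\ unitI a, unitI b & P = fpt q a b]].

Definition cube_cell (f : flip) : set V :=
  [set P | exists a b c, [/\ unitI a, unitI b, unitI c & P = cpt f a b c]].

Lemma cube_ptE (f : flip) (a b c : R) : cpt f a b c =
  ((1 - a) * (1 - b) * (1 - c)) *: ev (fw f) + (a * (1 - b) * (1 - c)) *: ev (fh0 f)
  + (a * b * (1 - c)) *: ev (fh1 f) + ((1 - a) * b * (1 - c)) *: ev (fh2 f)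
  + ((1 - a) * b * c) *: ev (fh3 f) + ((1 - a) * (1 - b) * c) *: ev (fh4 f)
  + (a * (1 - b) * c) *: ev (fh5 f) + (a * b * c) *: ev (fv f).
Proof.
rewrite /cube_pt sum_bool3 !big_bool /=.
by apply/rowP => j; rewrite !mxE; ring.
Qed.

Lemma unitI_onem (a : R) : unitI a -> unitI (1 - a).
Proof. by rewrite /unitI => /andP[h1 h2]; apply/andP; split; lra. Qed.

Lemma unitI0 : unitI (0 : R). Proof. by rewrite /unitI lexx ler01. Qed.
Lemma unitI1 : unitI (1 : R). Proof. by rewrite /unitI lexx ler01. Qed.

(** Old quadrilaterals are listed from the bottom vertex and new ones from the top vertex, whence
    the reversed parameters for the latter. *)
Lemma cube_pt_faces (f : flip) (a b : R) :
  [/\ cpt f 0 a b = fpt (old2 f) a b, cpt f b 0 a = fpt (old3 f) a b &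
      cpt f a b 0 = fpt (old1 f) a b] /\
  [/\ cpt f 1 a b = fpt (new3 f) (1 - a) (1 - b),
      cpt f b 1 a = fpt (new1 f) (1 - a) (1 - b) &
      cpt f a b 1 = fpt (new2 f) (1 - a) (1 - b)].
Proof.
by do !split; rewrite cube_ptE; apply/rowP => j; rewrite !mxE; ring.
Qed.

Lemma face_cell_cube (f : flip) (o : quad) :
  o \in cube_faces f -> face_cell o `<=` cube_cell f.
Proof.
move=> of_ P [a [b [ha hb ->]]].
have [[e1 e2 e3] _] := cube_pt_faces f a b.
have [_ [e4 e5 e6]] := cube_pt_faces f (1 - a) (1 - b).
have [h0 h1] := (unitI0, unitI1).
have [ha' hb'] := (unitI_onem ha, unitI_onem hb).
rewrite !subKr in e4 e5 e6.
move: of_; rewrite /cube_faces !inE.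
do ![case/orP]; move/eqP => ->.
- by exists a, b, 0.
- by exists 0, a, b.
- by exists b, 0, a.
- by exists (1 - b), 1, (1 - a).
- by exists (1 - a), (1 - b), 1.
- by exists 1, (1 - a), (1 - b).
Qed.

Lemma cube_boundary_face (f : flip) (a b c : R) :
  unitI a -> unitI b -> unitI c -> ~ [/\ 0 < a < 1, 0 < b < 1 & 0 < c < 1] ->
  exists2 o, o \in cube_faces f & face_cell o (cpt f a b c).
Proof.
move=> ha hb hc nint.
have [ha' hb' hc'] := And3 (unitI_onem ha) (unitI_onem hb) (unitI_onem hc).
have memf : [/\ [/\ old1 f \in cube_faces f, old2 f \in cube_faces f & old3 f \in cube_faces f],
   new1 f \in cube_faces f, new2 f \in cube_faces f & new3 f \in cube_faces f].
  by split; [split|..]; rewrite !inE !eqxx ?orbT.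
have [[m1 m2 m3] m4 m5 m6] := memf.
have edge (x : R) : unitI x -> [\/ x = 0, x = 1 | 0 < x < 1].
  rewrite /unitI le_eqVlt => /andP[/orP[/eqP<-|x0]]; first by constructor 1.
  by rewrite le_eqVlt => /orP[/eqP->|x1]; [constructor 2|constructor 3; rewrite x0].
have [[_ e2 _] [_ e5 _]] := cube_pt_faces f c a.
have [[_ _ e3] [_ _ e6]] := cube_pt_faces f a b.
have [[e1 _ _] [e4 _ _]] := cube_pt_faces f b c.
case: (edge a ha) => [->|->|ia].
- by exists (old2 f) => //; exists b, c.
- by exists (new3 f) => //; exists (1 - b), (1 - c).
case: (edge b hb) => [->|->|ib].
- by exists (old3 f) => //; exists c, a.
- by exists (new1 f) => //; exists (1 - c), (1 - a).
case: (edge c hc) => [->|->|ic]; last by case: nint.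
- by exists (old1 f) => //; exists a, b.
- by exists (new2 f) => //; exists (1 - a), (1 - b).
Qed.

Lemma face_cell_qrot q : face_cell (qrot q) `<=` face_cell q.
Proof.
move=> P [a [b [ha hb ->]]]; exists (1 - b), a; split=> //; first exact: unitI_onem.
by rewrite /face_pt; apply/rowP => j; rewrite !mxE /=; ring.
Qed.

Lemma face_cell_qrev q : face_cell (qrev q) `<=` face_cell q.
Proof.
move=> P [a [b [ha hb ->]]]; exists a, (1 - b); split=> //; first exact: unitI_onem.
by rewrite /face_pt; apply/rowP => j; rewrite !mxE /=; ring.
Qed.

Lemma face_cell_qeq q q' : qeq q q' -> face_cell q' `<=` face_cell q.
Proof.
have rot p P : face_cell (qrot p) P -> face_cell p P by exact: face_cell_qrot.
have rev P : face_cell (qrev q) P -> face_cell q P by exact: face_cell_qrev.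
move=> + P; rewrite /qeq !inE; do ![case/orP]; move/eqP => -> // H.
- exact: rot.
- exact: rot (rot _ _ H).
- exact: rot (rot _ _ (rot _ _ H)).
- exact: rev.
- exact: rev (rot _ _ H).
- exact: rev (rot _ _ (rot _ _ H)).
- exact: rev (rot _ _ (rot _ _ (rot _ _ H))).
Qed.

(** The third coordinate is ignored, so that faces and cubes are images of the same compact set. *)
Definition face_map (q : quad) (x : 'rV[R]_3) : V := fpt q (x 0 0) (x 0 1).
Definition cube_map (f : flip) (x : 'rV[R]_3) : V := cpt f (x 0 0) (x 0 1) (x 0 2).

Lemma continuous_cube_map f : continuous (cube_map f).
Proof.
suff H (x : 'rV[R]_3) : cube_map f @ x --> cube_map f x by [].
apply: (@continuous_coords _ _ _ (nbhs x) _) => j.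
rewrite /cube_map cube_ptE !mxE; under eq_fun do rewrite cube_ptE !mxE.
have cc i : (fun z : 'rV[R]_3 => z 0 i) @ x --> x 0 i by exact: coord_continuous.
have cc' i : (fun z : 'rV[R]_3 => 1 - z 0 i) @ x --> 1 - x 0 i.
  exact: (cvgB (cvg_cst (1 : R)) (cc i)).
have M3 (g1 g2 g3 : 'rV[R]_3 -> R) (k : R) : g1 @ x --> g1 x -> g2 @ x --> g2 x ->
    g3 @ x --> g3 x -> (fun z => g1 z * g2 z * g3 z * k) @ x --> g1 x * g2 x * g3 x * k.
  by move=> h1 h2 h3; exact: (cvgM (cvgM (cvgM h1 h2) h3) (cvg_cst k)).
exact: (cvgD (cvgD (cvgD (cvgD (cvgD (cvgD (cvgD
  (M3 _ _ _ _ (cc' 0) (cc' 1) (cc' 2)) (M3 _ _ _ _ (cc 0) (cc' 1) (cc' 2)))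
  (M3 _ _ _ _ (cc 0) (cc 1) (cc' 2))) (M3 _ _ _ _ (cc' 0) (cc 1) (cc' 2)))
  (M3 _ _ _ _ (cc' 0) (cc 1) (cc 2))) (M3 _ _ _ _ (cc' 0) (cc' 1) (cc 2)))
  (M3 _ _ _ _ (cc 0) (cc' 1) (cc 2))) (M3 _ _ _ _ (cc 0) (cc 1) (cc 2))).
Qed.

Lemma continuous_face_map q : continuous (face_map q).
Proof.
suff H (x : 'rV[R]_3) : face_map q @ x --> face_map q x by [].
apply: (@continuous_coords _ _ _ (nbhs x) _) => j.
rewrite /face_map /face_pt !mxE; under eq_fun do rewrite !mxE.
have cc i : (fun z : 'rV[R]_3 => z 0 i) @ x --> x 0 i by exact: coord_continuous.
have cc' i : (fun z : 'rV[R]_3 => 1 - z 0 i) @ x --> 1 - x 0 i.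
  exact: (cvgB (cvg_cst (1 : R)) (cc i)).
have M2 (g1 g2 : 'rV[R]_3 -> R) (k : R) : g1 @ x --> g1 x -> g2 @ x --> g2 x ->
    (fun z => g1 z * g2 z * k) @ x --> g1 x * g2 x * k.
  by move=> h1 h2; exact: (cvgM (cvgM h1 h2) (cvg_cst k)).
exact: (cvgD (cvgD (cvgD (M2 _ _ _ (cc' 0) (cc' 1)) (M2 _ _ _ (cc 0) (cc' 1)))
  (M2 _ _ _ (cc 0) (cc 1))) (M2 _ _ _ (cc' 0) (cc 1))).
Qed.

Lemma closed_image_unit_cube (g : 'rV[R]_3 -> V) :
  continuous g -> closed (g @` @unit_cube R).
Proof.
move=> gc; apply: compact_closed; first exact: norm_hausdorff.
apply: continuous_compact; last exact: compact_unit_cube.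
exact: continuous_subspaceT.
Qed.

Lemma pt3E (a b c : R) : [/\ pt3 a b c 0 0 = a, pt3 a b c 0 1 = b & pt3 a b c 0 2 = c].
Proof. by split; rewrite mxE. Qed.

Lemma unit_cube_pt3 (a b c : R) : unitI a -> unitI b -> unitI c -> unit_cube (pt3 a b c).
Proof. by move=> ha hb hc -[[|[|[|//]]] ?]; rewrite mxE. Qed.

Lemma face_cellE q : face_cell q = face_map q @` @unit_cube R.
Proof.
apply/seteqP; split => [P [a [b [ha hb ->]]]|P [x xA <-]].
  exists (pt3 a b 0); first by apply: unit_cube_pt3 => //; exact: unitI0.
  by rewrite /face_map; have [-> ->] := pt3E a b 0.
by exists (x 0 0), (x 0 1); split => //; exact: xA.
Qed.

Lemma cube_cellE f : cube_cell f = cube_map f @` @unit_cube R.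
Proof.
apply/seteqP; split => [P [a [b [c [ha hb hc ->]]]]|P [x xA <-]].
  exists (pt3 a b c); first exact: unit_cube_pt3.
  by rewrite /cube_map; have [-> -> ->] := pt3E a b c.
by exists (x 0 0), (x 0 1), (x 0 2); split => //; exact: xA.
Qed.

Lemma closed_face_cell q : closed (face_cell q).
Proof. by rewrite face_cellE; apply: closed_image_unit_cube; exact: continuous_face_map. Qed.

Lemma closed_cube_cell f : closed (cube_cell f).
Proof. by rewrite cube_cellE; apply: closed_image_unit_cube; exact: continuous_cube_map. Qed.

(** The coefficient of vertex [u] in [P]. As [inord] is faithful only for labels below [kN],
    membership in [kverts T0 F] is assumed below. *)
Definition weight_at (P : V) (u : nat) : R := P 0 (inord u).

Lemma weight_evec u v : u \in kverts T0 F -> weight_at (ev v) u = (u == v)%:R.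
Proof.
move=> uK; rewrite /weight_at mxE inordK //.
by rewrite ltnS; exact: (leq_bigmax_seq (F := fun v => v) _ uK isT).
Qed.

Lemma weightD P Q u : weight_at (P + Q) u = weight_at P u + weight_at Q u.
Proof. exact: mxE. Qed.
Lemma weightZ a P u : weight_at (a *: P) u = a * weight_at P u.
Proof. exact: mxE. Qed.

Lemma weight_face q a b u : u \in kverts T0 F ->
  weight_at (fpt q a b) u = (1 - a) * (1 - b) * (u == qv0 q)%:R
    + a * (1 - b) * (u == qv1 q)%:R + a * b * (u == qv2 q)%:R
    + (1 - a) * b * (u == qv3 q)%:R.
Proof. by move=> uK; rewrite /face_pt !weightD !weightZ !weight_evec. Qed.

Lemma weight_face_at q a b : uniq (qverts q) -> {subset qverts q <= kverts T0 F} ->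
  [/\ weight_at (fpt q a b) (qv0 q) = (1 - a) * (1 - b),
      weight_at (fpt q a b) (qv1 q) = a * (1 - b),
      weight_at (fpt q a b) (qv2 q) = a * b &
      weight_at (fpt q a b) (qv3 q) = (1 - a) * b].
Proof.
case: q => [[[q0 q1] q2] q3]; rewrite /qverts /qv0 /qv1 /qv2 /qv3 /= => u s.
have K x : x \in [:: q0; q1; q2; q3] -> x \in kverts T0 F by exact: s.
move: u; rewrite !inE !negb_or => /and4P[/and3P[n1 n2 n3] /andP[n4 n5] n6 _].
split; rewrite weight_face ?K ?inE ?eqxx ?orbT // /qv0 /qv1 /qv2 /qv3 /= ?eqxx;
 rewrite ?(negPf n1) ?(negPf n2) ?(negPf n3) ?(negPf n4) ?(negPf n5) ?(negPf n6)
   ?(eq_sym q1 q0) ?(eq_sym q2 q0) ?(eq_sym q3 q0) ?(eq_sym q2 q1) ?(eq_sym q3 q1) ?(eq_sym q3 q2);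
 rewrite ?(negPf n1) ?(negPf n2) ?(negPf n3) ?(negPf n4) ?(negPf n5) ?(negPf n6);
 rewrite /= ?mulr0 ?mulr1 ?addr0 ?add0r //.
Qed.

Lemma weight_face_notin q a b u : u \in kverts T0 F -> u \notin qverts q ->
  weight_at (fpt q a b) u = 0.
Proof.
move=> uK; rewrite /qverts !inE !negb_or => /and4P[/negPf n1 /negPf n2 /negPf n3 /negPf n4].
by rewrite weight_face // n1 n2 n3 n4 !mulr0 !addr0.
Qed.
End Cells.

Lemma cube_face_uniq (f : flip) (o : quad) :
  uniq (cube_verts f) -> o \in cube_faces f -> uniq (qverts o).
Proof.
rewrite /cube_verts /= !inE !negb_or -!andbA => U.
do ![case/andP: U => ? U]; clear U.
do ![case/orP]; move/eqP => ->;
  rewrite /qverts /qv0 /qv1 /qv2 /qv3 /= ?inE ?negb_or;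
  repeat (apply/andP; split); by [| rewrite eq_sym].
Qed.

Lemma cube_face_sub (f : flip) (o : quad) :
  o \in cube_faces f -> {subset qverts o <= cube_verts f}.
Proof.
by rewrite !inE; do ![case/orP]; move/eqP => -> x;
  rewrite /qverts /qv0 /qv1 /qv2 /qv3 /= ?inE;
  do ![case/orP]; move/eqP => ->; rewrite eqxx ?orbT.
Qed.

(** Turns the binary code of a corner into its position in [cube_verts], so that injectivity of
    [cvert] follows from [nth_uniq]. *)
Definition cvert_index (e : bool * bool * bool) : nat :=
  nth 0%N [:: 0; 5; 3; 4; 1; 6; 2; 7]%N (4 * e.1.1 + 2 * e.1.2 + e.2).

Lemma cvert_nth f e : cvert f e.1.1 e.1.2 e.2 = nth 0%N (cube_verts f) (cvert_index e).
Proof. by case: e => [[[] []] []]. Qed.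

Lemma cvert_in f a b c : cvert f a b c \in cube_verts f.
Proof. by rewrite (cvert_nth f (a, b, c)) mem_nth //; case: a b c => [] [] []. Qed.

Lemma cvert_inj f : uniq (cube_verts f) ->
  injective (fun e : bool * bool * bool => cvert f e.1.1 e.1.2 e.2).
Proof.
move=> U e e'; rewrite !cvert_nth => /eqP; rewrite nth_uniq //;
  try by case: (e) => [[[] []] []]. 
  by case: e => [[[] []] []]; case: e' => [[[] []] []].
by case: (e') => [[[] []] []].
Qed.

Lemma cube_verts_cvert f v : v \in cube_verts f -> exists a b c, v = cvert f a b c.
Proof.
rewrite !inE; do ![case/orP]; move/eqP => ->.
- by exists false, false, false.
- by exists true, false, false.
- by exists true, true, false.
- by exists false, true, false.
- by exists false, true, true.
- by exists false, false, true.
- by exists true, false, true.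
- by exists true, true, true.
Qed.

(** * The trilinear chart of a cube *)

Section Chart.
Variables (R : realType) (T0 : seq quad) (F : seq flip) (f : flip).
Local Notation V := 'rV[R]_(kN T0 F).
Local Notation fpt := (@face_pt R T0 F).
Local Notation cpt := (@cube_pt R T0 F).
Local Notation ev := (@evec R T0 F).
Local Notation cmap := (@cube_map R T0 F).
Hypothesis Uf : uniq (cube_verts f).
Hypothesis Kf : {subset cube_verts f <= kverts T0 F}.

Lemma weight_cube a b c e1 e2 e3 :
  weight_at (cpt f a b c) (cvert f e1 e2 e3) = wt e1 a * wt e2 b * wt e3 c.
Proof.
have uK := Kf (cvert_in f e1 e2 e3).
have -> : weight_at (cpt f a b c) (cvert f e1 e2 e3) = \sum_(e : bool * bool * bool)
    wt e.1.1 a * wt e.1.2 b * wt e.2 c * (cvert f e1 e2 e3 == cvert f e.1.1 e.1.2 e.2)%:R.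
  rewrite /weight_at /cube_pt summxE; apply: eq_bigr => e _.
  by rewrite -(weight_evec R _ uK) -weightZ.
rewrite (bigD1 (e1, e2, e3)) //= big1 ?addr0 ?eqxx ?mulr1 // => e ne.
by rewrite (inj_eq (cvert_inj Uf) (e1, e2, e3) e) eq_sym (negPf ne) mulr0.
Qed.

Definition reflect_pt (e : 'I_3 -> bool) (s : 'rV[R]_3) : 'rV[R]_3 :=
  \row_j if e j then 1 - s 0 j else s 0 j.

Lemma reflect_ptK e : involutive (reflect_pt e).
Proof. by move=> s; apply/rowP => j; rewrite !mxE; case: (e j) => //; rewrite subKr. Qed.

Lemma continuous_reflect_pt e : continuous (reflect_pt e).
Proof.
suff H (x : 'rV[R]_3) : reflect_pt e @ x --> reflect_pt e x by [].
apply: (@continuous_coords _ _ _ (nbhs x) _) => j.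
have cc : (fun z : 'rV[R]_3 => z 0 j) @ x --> x 0 j by exact: coord_continuous.
rewrite mxE; under eq_fun do rewrite mxE.
by case: (e j); [exact: (cvgB (cvg_cst (1 : R)) cc)|exact: cc].
Qed.

Lemma unit_cube_reflect e s : unit_cube s -> unit_cube (reflect_pt e s).
Proof. by move=> sA j; rewrite mxE; have := sA j; case: (e j) => // /unitI_onem. Qed.

(** A coordinate of a cube point is the total weight of the four vertices where that coordinate is
    1. This gives a linear left inverse of [cube_map], defined on the whole space. *)
Definition cube_coord (P : V) : 'rV[R]_3 :=
  let w a b c := weight_at P (cvert f a b c) in
  pt3 (w true false false + w true false true + w true true false + w true true true)
      (w false true false + w false true true + w true true false + w true true true)
      (w false false true + w false true true + w true false true + w true true true).

Lemma cube_coordK : cancel (cmap f) cube_coord.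
Proof.
move=> x; rewrite /cube_coord /cube_map !weight_cube /wt; apply/rowP => j.
by rewrite mxE; case: j => [[|[|[|//]]] i] /=;
 [rewrite (_ : Ordinal i = 0) | rewrite (_ : Ordinal i = 1) | rewrite (_ : Ordinal i = 2)];
 try exact: val_inj; ring.
Qed.

Lemma continuous_cube_coord : continuous cube_coord.
Proof.
suff H (x : V) : cube_coord @ x --> cube_coord x by [].
apply: (@continuous_coords _ _ _ (nbhs x) _) => j.
have cc i : (fun z : V => z 0 i) @ x --> x 0 i by exact: coord_continuous.
rewrite mxE; under eq_fun do rewrite mxE.
case: j => [[|[|[|//]]] i] /=; rewrite /weight_at;
 exact: (cvgD (cvgD (cvgD (cc _) (cc _)) (cc _)) (cc _)).
Qed.

(** A point on the diagonal of the side [k]; for small [d] it is an inner point of that side close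
    to the corner. *)
Definition near_corner (k : 'I_3) (d : R) : 'rV[R]_3 := \row_j if j == k then 0 else d.

Lemma cube_map_near_corner e k d :
  cmap f (reflect_pt e (near_corner k d)) = fpt (corner_quad f e k) d d.
Proof.
rewrite /cube_map cube_ptE /face_pt /corner_quad !mxE.
case: (e 0); case: (e 1); case: (e 2);
case: k => [[|[|[|//]]] i] /=; apply/rowP => j; rewrite !mxE /=; ring.
Qed.

Lemma cube_map_corner e : cmap f (reflect_pt e 0) = ev (cvert f (e 0) (e 1) (e 2)).
Proof.
rewrite /cube_map cube_ptE !mxE.
by case: (e 0); case: (e 1); case: (e 2); apply/rowP => j; rewrite !mxE /=; ring.
Qed.
End Chart.

(** * Cells through a point of a face close to a vertex *)

Section FreeFace.
Variables (R : realType) (T0 : seq quad) (F : seq flip).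
Local Notation V := 'rV[R]_(kN T0 F).
Local Notation fpt := (@face_pt R T0 F).
Local Notation cpt := (@cube_pt R T0 F).
Local Notation K := (kverts T0 F).

(** For [d] below 1/2 the weights satisfy (1-d)^2 > d(1-d) > d^2 > 0, the order that
    [qeq_of_weights] requires. *)
Lemma near_corner_weights (q : quad) (d : R) :
  uniq (qverts q) -> {subset qverts q <= K} -> 0 < d -> d < 2^-1 ->
  let w := weight_at (fpt q d d) in
  [/\ 0 < w (qv2 q), w (qv2 q) < w (qv1 q), w (qv2 q) < w (qv3 q),
      w (qv1 q) < w (qv0 q) & w (qv3 q) < w (qv0 q)].
Proof.
move=> u s d0 d2 w; rewrite /w.
by have [-> -> -> ->] := weight_face_at d d u s; split; nra.
Qed.

Lemma near_corner_weight_gt0 (q : quad) (d : R) (u : nat) :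
  uniq (qverts q) -> {subset qverts q <= K} -> 0 < d -> d < 2^-1 ->
  u \in qverts q -> 0 < weight_at (fpt q d d) u.
Proof.
move=> uq s d0 d2; have [h1 h2 h3 h4 h5] := near_corner_weights uq s d0 d2.
by rewrite !inE => /or4P[] /eqP ->; lra.
Qed.

(** All four weights are positive, so [q'] has the same vertices; the order of the weights fixes the
    cyclic order. *)
Lemma near_corner_face (q q' : quad) (d : R) :
  uniq (qverts q) -> {subset qverts q <= K} -> 0 < d -> d < 2^-1 ->
  uniq (qverts q') -> {subset qverts q' <= K} ->
  face_cell q' (fpt q d d) -> qeq q q'.
Proof.
move=> uq sq d0 d2 uq' sq' [a [b [_ _ E]]].
have [h1 h2 h3 h4 h5] := near_corner_weights uq sq d0 d2.
apply: (@qeq_of_weights _ (weight_at (fpt q d d))) => //.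
  move=> u uin; apply: contraT => nu.
  have := near_corner_weight_gt0 uq sq d0 d2 uin.
  by rewrite E weight_face_notin ?ltxx //; exact: sq.
by rewrite E; have [-> -> -> ->] := weight_face_at a b uq' sq'; ring.
Qed.

(** An inner point of a cube has eight vertices of nonzero weight, the given point only four. So it
    lies on the boundary of the cube. *)
Lemma near_corner_cube (q : quad) (f : flip) (d : R) :
  uniq (qverts q) -> {subset qverts q <= K} -> 0 < d -> d < 2^-1 ->
  uniq (cube_verts f) -> {subset cube_verts f <= K} ->
  cube_cell f (fpt q d d) -> exists2 o, o \in cube_faces f & qeq q o.
Proof.
move=> uq sq d0 d2 uf sf [a [b [c [ha hb hc E]]]].
have [[/andP[a0 a1] /andP[b0 b1] /andP[c0 c1]]|nint] :=
    pselect [/\ 0 < a < 1, 0 < b < 1 & 0 < c < 1].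
  have sub : {subset cube_verts f <= qverts q}.
    move=> u uin; apply: contraT => nu.
    have := weight_face_notin d d (sf _ uin) nu.
    have [e1 [e2 [e3 ue]]] := cube_verts_cvert uin.
    rewrite E ue (weight_cube uf sf) => /eqP.
    have W (e : bool) (x : R) : 0 < x -> x < 1 -> wt e x != 0.
      by case: e => x0 x1 /=; rewrite gt_eqF // subr_gt0.
    by rewrite !mulf_eq0 !(negPf (W _ _ _ _)).
  by have := uniq_leq_size uf sub.
have [g of_ ocell] := cube_boundary_face T0 F f ha hb hc nint.
exists g => //; apply: (near_corner_face uq sq d0 d2 (cube_face_uniq uf of_)).
  by move=> x /(cube_face_sub of_)/sf.
by rewrite E; exact: ocell.
Qed.

Hypothesis faceK : forall q, q \in kfaces T0 F ->
  uniq (qverts q) /\ {subset qverts q <= K}.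
Hypothesis cubeK : forall j, (j < size F)%N ->
  uniq (cube_verts (nth flip0 F j)) /\ {subset cube_verts (nth flip0 F j) <= K}.

(* Near an inner point of a face lying in a single cube, the realization is a
   half-space. *)
Lemma free_face_not_interior (i : nat) (o : quad) (v : nat) :
  (i < size F)%N -> o \in cube_faces (nth flip0 F i) -> v \in qverts o ->
  (forall j o', (j < size F)%N -> o' \in cube_faces (nth flip0 F j) ->
     qeq o o' -> j = i) ->
  ~ interior_vertex R T0 F v.
Proof.
move=> iF of_ vo only [_ [U [UX Uv UO Uh]]].
have [uf sf] := cubeK iF.
set f := nth flip0 F i in of_ uf sf.
have [e [k [ve qo]]] := cube_face_corner of_ vo.
set q := corner_quad f e k in qo.
have uq : uniq (qverts q) by rewrite (qeq_uniq qo) (cube_face_uniq uf of_).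
have sq : {subset qverts q <= K}.
  by move=> x; rewrite (qeq_mem qo) => /(cube_face_sub of_)/sf.
pose phi s : V := @cube_map R T0 F f (reflect_pt e s).
pose chi (P : V) := reflect_pt e (cube_coord f P).
have phic : continuous phi.
  by move=> x; apply: continuous_comp; [exact: continuous_reflect_pt|exact: continuous_cube_map].
have chic : continuous chi.
  by move=> x; apply: continuous_comp; [exact: continuous_cube_coord|exact: continuous_reflect_pt].
have phiK : cancel phi chi.
  by move=> s; rewrite /chi /phi (cube_coordK uf sf) reflect_ptK.
have phiX s : unit_cube s -> @realization R T0 F (phi s).
  move=> /(unit_cube_reflect e) sA; right; exists i => //.
  by exists (reflect_pt e s 0 0), (reflect_pt e s 0 1), (reflect_pt e s 0 2); split=> //; exact: sA.
(* The chart sends 0 to [v], so the neighbourhood [U] of [v] contains inner points of the face near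
   that corner. *)
have [d [d0 d2 Ud]] : exists d, [/\ 0 < d, d < 2^-1 & U (phi (near_corner k d))].
  have [W Wo UE] := UO.
  have : W (phi 0) by move: Uv; rewrite UE ve -(cube_map_corner R T0 F f e) => -[].
  move=> W0; have nW : nbhs (phi 0) W by apply: open_nbhs_nbhs.
  have /nbhs_ballP[r /= r0 Hr] := phic 0 _ nW.
  exists (Num.min r (2^-1) / 2).
  have m0 : 0 < Num.min r (2^-1) by rewrite lt_min r0 invr_gt0 ltr0n.
  have mr : Num.min r (2^-1) <= r by rewrite ge_min lexx.
  have m2 : Num.min r (2^-1) <= 2^-1 by rewrite ge_min lexx orbT.
  move: (Num.min _ _) m0 mr m2 => m m0 mr m2.
  split; [lra|lra|].
  rewrite UE; split.
    apply: Hr; apply/rV_ballP; split => // j; rewrite !mxE sub0r normrN.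
    by case: ifP; rewrite ?normr0 // => _; rewrite gtr0_norm; lra.
  by apply: phiX => j; rewrite mxE; case: ifP => _; apply/andP; split; lra.
set s0 := near_corner k d in Ud.
have pE : phi s0 = fpt q d d by exact: cube_map_near_corner.
apply: (@half_space_not_ball R _ (@realization R T0 F) U phi chi k s0) => //.
- by rewrite mxE eqxx.
- apply/nbhs_ballP; exists d => //= s /rV_ballP[_ sB] sk; apply: phiX => j.
  have := sB j; rewrite mxE; case: eqP => [->|_].
    by rewrite sub0r normrN ger0_norm // => h; rewrite sk /=; lra.
  by rewrite ltr_norml => /andP[h1 h2]; apply/andP; split; lra.
have nF : \forall P \near phi s0, forall q', q' \in kfaces T0 F ->
    face_cell q' P -> face_cell q' (phi s0).
  by apply: near_all_seq => q' _; apply: near_closed; exact: closed_face_cell.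
have nC : \forall P \near phi s0, forall j, j \in iota 0 (size F) ->
    cube_cell (nth flip0 F j) P -> cube_cell (nth flip0 F j) (phi s0).
  by apply: near_all_seq => j _; apply: near_closed; exact: closed_cube_cell.
have inC P : cube_cell f P -> exists2 s : 'rV[R]_3, 0 <= s 0 k & P = phi s.
  rewrite cube_cellE => -[x xA <-]; exists (reflect_pt e x); last by rewrite /phi reflect_ptK.
  by have /andP[] := unit_cube_reflect e xA k.
(* A cell met close to [phi s0] passes through it: a face is then [o] itself and lies in the cube of
   [f], and a cube has [o] among its faces, so it is the cube of [f]. *)
apply: filterS2 nF nC => P HF HC [[q' [q'F qP]]|[j jF jP]]; apply: inC.
  have [uq' sq'] := faceK q'F.
  have := HF _ q'F qP; rewrite pE => /(near_corner_face uq sq d0 d2 uq' sq') qq'.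
  apply: (face_cell_cube of_); apply: (face_cell_qeq (qeq_sym qo)).
  have qP' : face_cell q' P by exact: qP.
  exact: (face_cell_qeq qq' qP').
have [uj sj] := cubeK jF.
have jin : j \in iota 0 (size F) by rewrite mem_iota.
have := HC _ jin jP; rewrite pE => /(near_corner_cube uq sq d0 d2 uj sj)[g gj qg].
have ji : j = i by apply: only jF gj _; exact: qeq_trans (qeq_sym qo) qg.
by rewrite /f -ji; exact: jP.
Qed.
End FreeFace.

(** * Piles: planar geometry and freshness of vertices *)

Definition olds (f : flip) : seq quad := [:: old1 f; old2 f; old3 f].
Definition news (f : flip) : seq quad := [:: new1 f; new2 f; new3 f].

Lemma cube_faces_cat f : cube_faces f = olds f ++ news f.
Proof. by []. Qed.

(** A dihedral symmetry that fixes a vertex fixes the opposite one. *)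
Lemma qeq_opposite w a b c a' b' c' :
  uniq [:: w; a; b; c] -> qeq (w, a, b, c) (w, a', b', c') -> b = b'.
Proof.
rewrite /= !inE !negb_or -!andbA => /and4P[n1 n2 n3 _].
rewrite /qeq /qrot /qrev /qv0 /qv1 /qv2 /qv3 /= !inE.
do ![case/orP]; case/eqP => // *; subst; by rewrite ?eqxx in n1 n2 n3.
Qed.

Section Canon.

(** A chosen representative of the dihedral class; it turns [qeq] into equality, so that lists of
    faces can be compared as permutations. *)
Definition quad_canon (q : quad) : quad := choose (qeq q) q.

Lemma qeq_canon q : qeq q (quad_canon q).
Proof. exact: (chooseP (qeq_refl q)). Qed.

Lemma quad_canonP q q' : reflect (quad_canon q = quad_canon q') (qeq q q').
Proof.
apply: (iffP idP) => [qq|E].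
  rewrite /quad_canon (@eq_choose _ _ (qeq q')); last first.
    by move=> x; apply/idP/idP; apply: qeq_trans => //; exact: qeq_sym.
  by apply: choose_id => //; [exact: qeq_sym|exact: qeq_refl].
by apply: qeq_trans (qeq_canon q) _; rewrite E; apply: qeq_sym; exact: qeq_canon.
Qed.

Lemma uniq_canon_flatten (G : flip -> seq quad) (F : seq flip) :
  (forall i, (i < size F)%N -> uniq (map quad_canon (G (nth flip0 F i)))) ->
  (forall i j p q, (i < j)%N -> (j < size F)%N -> p \in G (nth flip0 F i) ->
     q \in G (nth flip0 F j) -> ~ qeq p q) ->
  uniq (map quad_canon (flatten (map G F))).
Proof.
elim: F => [//|f F IH] H1 H2 /=; rewrite map_cat cat_uniq.
rewrite (H1 0%N) //= IH ?andbT; last first.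
- by move=> i j p q ij jF; exact: (H2 i.+1 j.+1 p q).
- by move=> i iF; exact: (H1 i.+1).
apply/hasPn => c cin; have [q qin ->] := mapP cin.
have [s sF qs] := flattenP qin.
apply/negP => cin'; have [p pf /esym /quad_canonP pq] := mapP cin'.
have [j jF js] := nthP [::] sF; rewrite size_map in jF.
by apply: (H2 0%N j.+1 p q) pq => //=; rewrite -(nth_map flip0 [::]) ?js.
Qed.
End Canon.

(** * Nondegenerate quadrilaterals meeting face to face *)

Section Geometry.
Variables (R : realType) (pos : nat -> 'rV[R]_2).

Definition nondegenerate_quad (q : quad) : Prop :=
  let c i j k := collinear (pos i) (pos j) (pos k) in
  [/\ ~ c (qv0 q) (qv1 q) (qv2 q), ~ c (qv1 q) (qv2 q) (qv3 q),
      ~ c (qv2 q) (qv3 q) (qv0 q) & ~ c (qv3 q) (qv0 q) (qv1 q)].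

Lemma collinear_rev (a b c : 'rV[R]_2) : collinear a b c -> collinear c b a.
Proof. by rewrite /collinear /det2 => H; rewrite -[RHS]oppr0 -H; ring. Qed.

Lemma collinear_rot (a b c : 'rV[R]_2) : collinear a b c -> collinear b c a.
Proof. by rewrite /collinear /det2 => H; rewrite -[RHS]H; ring. Qed.

Lemma collinear_dup (a b : 'rV[R]_2) : collinear a a b.
Proof. by rewrite /collinear /det2; ring. Qed.

Lemma nondegenerate_qeq q q' : qeq q q' -> nondegenerate_quad q -> nondegenerate_quad q'.
Proof.
have rot p : nondegenerate_quad p -> nondegenerate_quad (qrot p) by case.
have rev p : nondegenerate_quad p -> nondegenerate_quad (qrev p).
  by case=> h1 h2 h3 h4; split=> /collinear_rev.
by rewrite /qeq !inE; do ![case/orP]; move/eqP => ->; auto 6.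
Qed.

Lemma nondegenerate_uniq q : nondegenerate_quad q -> uniq (qverts q).
Proof.
case: q => [[[a b] c] d]; rewrite /nondegenerate_quad /qverts /qv0 /qv1 /qv2 /qv3 /=.
move=> [h1 h2 h3 h4]; rewrite !inE !negb_or.
have d1 x y : collinear (pos x) (pos x) (pos y) by exact: collinear_dup.
have d2 x y : collinear (pos y) (pos x) (pos x) by exact: collinear_rev.
have d3 x y : collinear (pos x) (pos y) (pos x) by do 2!apply: collinear_rot.
repeat (apply/andP; split) => //; apply/eqP => E; subst;
  solve [apply: h1; by [apply: d1|apply: d2|apply: d3]
    | apply: h2; by [apply: d1|apply: d2|apply: d3]
    | apply: h3; by [apply: d1|apply: d2|apply: d3]
    | apply: h4; by [apply: d1|apply: d2|apply: d3]].
Qed.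

Lemma tri_corner (a b c : 'rV[R]_2) : [/\ tri a b c a, tri a b c b & tri a b c c].
Proof.
split.
- by exists 1, 0, 0; split; rewrite ?ler01 ?lexx ?addr0 ?scale1r ?scale0r ?addr0.
- by exists 0, 1, 0; split; rewrite ?ler01 ?lexx ?addr0 ?add0r ?scale1r ?scale0r ?addr0 ?add0r.
- by exists 0, 0, 1; split; rewrite ?ler01 ?lexx ?addr0 ?add0r ?scale1r ?scale0r ?addr0 ?add0r.
Qed.

Lemma quad_region_vertex q u : u \in qverts q -> quad_region pos q (pos u).
Proof.
have T := tri_corner.
rewrite /quad_region !inE; case: ifP => _ /or4P[] /eqP ->;
 by [left; case: (T (pos (qv0 q)) (pos (qv1 q)) (pos (qv2 q)))
    |right; case: (T (pos (qv0 q)) (pos (qv2 q)) (pos (qv3 q)))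
    |left; case: (T (pos (qv1 q)) (pos (qv2 q)) (pos (qv3 q)))
    |right; case: (T (pos (qv1 q)) (pos (qv3 q)) (pos (qv0 q)))].
Qed.

Lemma seg_collinear (p p' a b c : 'rV[R]_2) :
  seg p p' a -> seg p p' b -> seg p p' c -> collinear a b c.
Proof.
move=> [s _ ->] [t _ ->] [u _ ->]; rewrite /collinear /det2 !mxE; ring.
Qed.

(** Common vertices lie in the intersection of the regions, which is empty, a point or a segment. *)
Lemma face_to_face_collinear q q' a b c : face_to_face pos q q' ->
  {subset [:: a; b; c] <= qverts q} -> {subset [:: a; b; c] <= qverts q'} ->
  collinear (pos a) (pos b) (pos c).
Proof.
move=> ff s s'.
have X u : u \in [:: a; b; c] -> (quad_region pos q `&` quad_region pos q') (pos u).
  by move=> h; split; apply: quad_region_vertex; [exact: s|exact: s'].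
have Xa := X a ltac:(by rewrite !inE eqxx).
have Xb := X b ltac:(by rewrite !inE eqxx orbT).
have Xc := X c ltac:(by rewrite !inE eqxx !orbT).
move: ff Xa Xb Xc; rewrite /face_to_face => -[->|[p _ ->]|[p [p' [_ _ ->]]]].
- by [].
- by move=> /= -> -> ->; exact: collinear_dup.
- exact: seg_collinear.
Qed.
End Geometry.

(** * Vertices and faces along a pile *)

Section Pile.
Variables (R : realType) (Rg : set 'rV[R]_2) (pos : nat -> 'rV[R]_2).
Variables (T0 : seq quad) (F : seq flip).
Hypothesis pile : is_pile pos Rg T0 F.
Local Notation f_ i := (nth flip0 F i).
Local Notation T_ n := (pile_T T0 F n).
Local Notation K_ n := (kverts T0 (take n F)).

Lemma pile_TS n : (n < size F)%N -> T_ n.+1 = apply_flip (T_ n) (f_ n).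
Proof. by move=> nF; rewrite /pile_T (take_nth flip0) // foldl_rcons. Qed.

Lemma mem_kverts_take n v : (n <= size F)%N ->
  v \in K_ n <-> v \in Tverts T0 \/ exists2 j, (j < n)%N & v = fv (f_ j).
Proof.
move=> nF; rewrite mem_cat; split=> [/orP[|vin]|]; first by left.
- right; have [j] := nthP 0%N vin; rewrite size_map size_takel // => jn <-.
  by exists j => //; rewrite (nth_map flip0) ?size_takel // nth_take.
- case=> [->//|[j jn ->]]; apply/orP; right; apply/(nthP 0%N); exists j.
    by rewrite size_map size_takel.
  by rewrite (nth_map flip0) ?size_takel // nth_take.
Qed.

Lemma mem_kfaces q : q \in kfaces T0 F <->
  q \in T0 \/ exists2 j, (j < size F)%N & q \in news (f_ j).
Proof.
rewrite mem_cat; split=> [/orP[|qin]|]; first by left.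
- right; have [s sF qs] := flattenP qin.
  have [j jF js] := nthP [::] sF; rewrite size_map in jF.
  by exists j => //; rewrite -[news _](nth_map flip0 [::] news) // js.
- case=> [->//|[j jF qj]]; apply/orP; right; apply/flattenP; exists (news (f_ j)) => //.
  by apply/(nthP [::]); exists j; rewrite ?size_map // (nth_map flip0).
Qed.

Lemma kverts_take_sub m n : (m <= n)%N -> (n <= size F)%N -> {subset K_ m <= K_ n}.
Proof.
move=> mn nF v /(mem_kverts_take _ (leq_trans mn nF)) H.
apply/(mem_kverts_take _ nF); case: H => [|[j jm ->]]; [by left|right].
by exists j => //; exact: leq_trans jm mn.
Qed.

Lemma kverts_takeF n : (n <= size F)%N -> {subset K_ n <= kverts T0 F}.
Proof. by move=> nF v vn; rewrite -[F]take_size; apply: (kverts_take_sub nF). Qed.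

Lemma flip_fresh n : (n < size F)%N -> fv (f_ n) \notin K_ n.
Proof. by case: pile => _ _ /(_ n) + nF => /(_ nF)[]. Qed.

Lemma old_in_pile n p : (n < size F)%N -> p \in olds (f_ n) ->
  exists2 q, q \in T_ n & qeq p q.
Proof.
case: pile => _ _ /(_ n) + nF => /(_ nF)[/hasP[q1 i1 e1] /hasP[q2 i2 e2] /hasP[q3 i3 e3] _ _].
by rewrite !inE => /or3P[] /eqP ->; [exists q1|exists q2|exists q3].
Qed.

Lemma mem_pile n q : (n <= size F)%N -> q \in T_ n ->
  q \in T0 \/ exists2 j, (j < n)%N & q \in news (f_ j).
Proof.
elim: n => [|n IH] nF; first by rewrite /pile_T take0; left.
rewrite pile_TS // /apply_flip mem_cat => /orP[|qn]; last by right; exists n.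
rewrite mem_filter => /andP[_ /(IH (ltnW nF))[|[j jn qj]]]; [by left|right].
by exists j => //; exact: ltnW.
Qed.

Lemma news_in_pile n q : (n < size F)%N -> q \in news (f_ n) -> q \in T_ n.+1.
Proof. by move=> nF qn; rewrite pile_TS // mem_cat [_ \in [:: new1 _; _; _]]qn orbT. Qed.

Lemma hexagon_in_olds (f : flip) p v :
  p \in news f -> v \in qverts p -> v = fv f \/ exists2 q, q \in olds f & v \in qverts q.
Proof.
move=> pf vp.
have H : v \in [:: fv f; fh0 f; fh1 f; fh2 f; fh3 f; fh4 f; fh5 f].
  move: pf vp; rewrite !inE => /or3P[] /eqP ->; rewrite /qv0 /qv1 /qv2 /qv3 /=;
  by move=> /or4P[] /eqP ->; rewrite eqxx ?orbT.
move: H; rewrite in_cons => /orP[/eqP|H]; first by left.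
right; move: H; rewrite !inE; do ![case/orP]; move/eqP => ->.
- by exists (old1 f); rewrite !inE /qv1 eqxx ?orbT.
- by exists (old1 f); rewrite !inE /qv2 eqxx ?orbT.
- by exists (old1 f); rewrite !inE /qv3 eqxx ?orbT.
- by exists (old2 f); rewrite !inE /qv2 eqxx ?orbT.
- by exists (old3 f); rewrite !inE /qv1 eqxx ?orbT.
- by exists (old3 f); rewrite !inE /qv2 eqxx ?orbT.
Qed.

Lemma face_verts n q : (n <= size F)%N ->
  (q \in T0 \/ exists2 j, (j < n)%N & q \in news (f_ j)) ->
  {subset qverts q <= K_ n}.
Proof.
elim: n q => [|n IH] q nF.
  case=> [qT|[j //]] v vq; rewrite /kverts take0 mem_cat; apply/orP; left.
  by apply/flattenP; exists (qverts q) => //; exact: map_f.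
have sub := kverts_take_sub (leqnSn n) nF.
case=> [qT|[j]]; first by move=> v vq; apply/sub/(IH q (ltnW nF)) => //; left.
rewrite ltnS leq_eqVlt => /orP[/eqP->|jn] qj v vq; last first.
  by apply/sub/(IH q (ltnW nF)) => //; right; exists j.
have [->|[p pf vp]] := hexagon_in_olds qj vq.
  by apply/(mem_kverts_take _ nF); right; exists n.
have [q' q'T pq'] := old_in_pile nF pf.
apply/sub/(IH q' (ltnW nF)); first exact: mem_pile (ltnW nF) q'T.
by rewrite -(qeq_mem pq').
Qed.

Lemma pile_verts n q : (n <= size F)%N -> q \in T_ n -> {subset qverts q <= K_ n}.
Proof. by move=> nF /(mem_pile nF); exact: face_verts. Qed.

Lemma olds_verts n p : (n < size F)%N -> p \in olds (f_ n) -> {subset qverts p <= K_ n}.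
Proof.
move=> nF /(old_in_pile nF)[q qT pq] v; rewrite (qeq_mem pq).
exact: pile_verts (ltnW nF) qT v.
Qed.

Lemma news_fv f p : p \in news f -> fv f \in qverts p.
Proof. by rewrite !inE => /or3P[] /eqP ->; rewrite eqxx. Qed.

Lemma pile_nondegenerate n q : (n <= size F)%N -> q \in T_ n -> nondegenerate_quad pos q.
Proof. by case: pile => _ /(_ n) + _ nF => /(_ nF)[+ _ _ _] => /(_ q) + qT => /(_ qT)[]. Qed.

Lemma news_nondegenerate n q : (n < size F)%N -> q \in news (f_ n) -> nondegenerate_quad pos q.
Proof. by move=> nF /(news_in_pile nF); exact: pile_nondegenerate. Qed.

Lemma olds_nondegenerate n p : (n < size F)%N -> p \in olds (f_ n) -> nondegenerate_quad pos p.
Proof.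
move=> nF /(old_in_pile nF)[q qT /qeq_sym pq].
exact: nondegenerate_qeq pq (pile_nondegenerate (ltnW nF) qT).
Qed.

(** Inequivalent faces occupy distinct positions in the quadrangulation, so they meet face to
    face. *)
Lemma olds_collinear n p p' a b c : (n < size F)%N ->
  p \in olds (f_ n) -> p' \in olds (f_ n) -> ~ qeq p p' ->
  {subset [:: a; b; c] <= qverts p} -> {subset [:: a; b; c] <= qverts p'} ->
  collinear (pos a) (pos b) (pos c).
Proof.
move=> nF /(old_in_pile nF)[q qT pq] /(old_in_pile nF)[q' q'T pq'] npp s s'.
have sq : {subset [:: a; b; c] <= qverts q} by move=> x /s; rewrite (qeq_mem pq).
have sq' : {subset [:: a; b; c] <= qverts q'} by move=> x /s'; rewrite (qeq_mem pq').
apply: (face_to_face_collinear _ sq sq').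
case: pile => _ /(_ n (ltnW nF))[_ _ _ H] _.
have := H (index q (T_ n)) (index q' (T_ n)).
rewrite !index_mem qT q'T !nth_index // => /(_ isT isT)[|//] E.
apply: npp; apply: qeq_trans pq _; apply: qeq_sym; rewrite (_ : q = q') //.
by rewrite -(nth_index (0, 0, 0, 0)%N qT) E nth_index.
Qed.

(** [behead (rev (cube_verts _))] lists the seven vertices other than the top one; all of them lie
    on old faces. *)
Lemma cube_verts_sub n : (n < size F)%N ->
  {subset behead (rev (cube_verts (f_ n))) <= K_ n} /\
  {subset cube_verts (f_ n) <= kverts T0 F}.
Proof.
move=> nF.
have o1 := olds_verts nF (p := old1 (f_ n)) ltac:(by rewrite !inE eqxx).
have o2 := olds_verts nF (p := old2 (f_ n)) ltac:(by rewrite !inE eqxx orbT).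
have o3 := olds_verts nF (p := old3 (f_ n)) ltac:(by rewrite !inE eqxx !orbT).
have sub : {subset behead (rev (cube_verts (f_ n))) <= K_ n}.
  move=> v; rewrite !inE; do ![case/orP]; move/eqP => ->;
   solve [apply: o1; rewrite !inE /qv0 /qv1 /qv2 /qv3 /= eqxx ?orbT //
   | apply: o2; rewrite !inE /qv0 /qv1 /qv2 /qv3 /= eqxx ?orbT //
   | apply: o3; rewrite !inE /qv0 /qv1 /qv2 /qv3 /= eqxx ?orbT //].
split=> // v; rewrite -mem_rev [rev _]/= in_cons => /orP[/eqP->|/sub vK].
  rewrite -[F in kverts T0 F]take_size; apply/(mem_kverts_take _ (leqnn _)).
  by right; exists n.
exact: kverts_takeF (ltnW nF) v vK.
Qed.

(** Vertices on a common face differ by nondegeneracy, and the top vertex is fresh. There remain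
    opposite hexagon vertices: if two coincided, two old faces would share three non-collinear
    vertices. *)
Lemma cube_verts_uniq n : (n < size F)%N -> uniq (cube_verts (f_ n)).
Proof.
move=> nF; have fresh := flip_fresh nF; have [sub _] := cube_verts_sub nF.
set f := f_ n in fresh sub *.
have in1 : old1 f \in olds f by rewrite !inE eqxx.
have in2 : old2 f \in olds f by rewrite !inE eqxx orbT.
have in3 : old3 f \in olds f by rewrite !inE eqxx !orbT.
have ou p : p \in olds f -> uniq (qverts p).
  by move=> pf; apply: (@nondegenerate_uniq R pos); exact: olds_nondegenerate nF pf.
have nu p : p \in news f -> uniq (qverts p).
  by move=> pf; apply: (@nondegenerate_uniq R pos); exact: news_nondegenerate nF pf.
have u1 := ou _ in1; have u2 := ou _ in2; have u3 := ou _ in3.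
have v1 := nu (new1 f) ltac:(by rewrite !inE eqxx).
have v2 := nu (new2 f) ltac:(by rewrite !inE eqxx orbT).
have v3 := nu (new3 f) ltac:(by rewrite !inE eqxx !orbT).
have nv u : u \in behead (rev (cube_verts f)) -> u != fv f.
  by move=> /sub uK; apply: contraNneq fresh => <-.
have w0 := nv (fw f) ltac:(by rewrite !inE eqxx ?orbT).
have w1 := nv (fh0 f) ltac:(by rewrite !inE eqxx ?orbT).
have w2 := nv (fh1 f) ltac:(by rewrite !inE eqxx ?orbT).
have w3 := nv (fh2 f) ltac:(by rewrite !inE eqxx ?orbT).
have w4 := nv (fh3 f) ltac:(by rewrite !inE eqxx ?orbT).
have w5 := nv (fh4 f) ltac:(by rewrite !inE eqxx ?orbT).
have w6 := nv (fh5 f) ltac:(by rewrite !inE eqxx ?orbT).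
have [n1 _ _ n4] := olds_nondegenerate nF in1.
have o12 : ~ qeq (old1 f) (old2 f).
  move=> /(qeq_opposite u1) E; have {}E : fh1 f = fh3 f := E; move: v1.
  by rewrite /qverts /qv0 /qv1 /qv2 /qv3 /= E !inE eqxx ?orbT ?andbF.
have o13 : ~ qeq (old1 f) (old3 f).
  move=> /(qeq_opposite u1) E; have {}E : fh1 f = fh5 f := E; move: v3.
  by rewrite /qverts /qv0 /qv1 /qv2 /qv3 /= E !inE eqxx ?orbT ?andbF.
have h03 : fh0 f != fh3 f.
  apply/eqP => E; apply: n4; apply: (olds_collinear nF in1 in2 o12) => x;
  by rewrite !inE /qv0 /qv1 /qv2 /qv3 /= => /or3P[] /eqP ->; rewrite ?E eqxx ?orbT.
have h14 : fh1 f != fh4 f.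
  apply/eqP => E; apply: n1; apply: (olds_collinear nF in1 in3 o13) => x;
  by rewrite !inE /qv0 /qv1 /qv2 /qv3 /= => /or3P[] /eqP ->; rewrite ?E eqxx ?orbT.
have h25 : fh2 f != fh5 f.
  apply/eqP => E; apply: n4; apply: (olds_collinear nF in1 in3 o13) => x;
  by rewrite !inE /qv0 /qv1 /qv2 /qv3 /= => /or3P[] /eqP ->; rewrite ?E eqxx ?orbT.
move: u1 u2 u3 v1 v2 v3.
rewrite /qverts /qv0 /qv1 /qv2 /qv3 /= !inE !negb_or -!andbA.
do 6!(do 6!(case/andP => ?); move=> _).
repeat (apply/andP; split) => //; by rewrite eq_sym.
Qed.
End Pile.

Lemma news_not_qeq f : uniq (cube_verts f) ->
  [/\ ~ qeq (new1 f) (new2 f), ~ qeq (new1 f) (new3 f) & ~ qeq (new2 f) (new3 f)].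
Proof.
move=> U.
have u1 : uniq (qverts (new1 f)) by apply: (cube_face_uniq U); rewrite !inE eqxx ?orbT.
have u2 : uniq (qverts (new2 f)) by apply: (cube_face_uniq U); rewrite !inE eqxx ?orbT.
move: U; rewrite /cube_verts /= !inE !negb_or -!andbA => U.
do ![case/andP: U => ? U]; clear U.
by split; [move/(qeq_opposite u1)|move/(qeq_opposite u1)|move/(qeq_opposite u2)];
  move/eqP; apply/negP; rewrite /qv2 /=; by [|rewrite eq_sym].
Qed.

Lemma olds_not_qeq f : uniq (cube_verts f) ->
  [/\ ~ qeq (old1 f) (old2 f), ~ qeq (old1 f) (old3 f) & ~ qeq (old2 f) (old3 f)].
Proof.
move=> U.
have u1 : uniq (qverts (old1 f)) by apply: (cube_face_uniq U); rewrite !inE eqxx ?orbT.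
have u2 : uniq (qverts (old2 f)) by apply: (cube_face_uniq U); rewrite !inE eqxx ?orbT.
move: U; rewrite /cube_verts /= !inE !negb_or -!andbA => U.
do ![case/andP: U => ? U]; clear U.
by split; [move/(qeq_opposite u1)|move/(qeq_opposite u1)|move/(qeq_opposite u2)];
  move/eqP; apply/negP; rewrite /qv2 /=.
Qed.

(** * Each face at an interior vertex lies in two cubes *)

Section PileInterior.
Variables (R : realType) (Rg : set 'rV[R]_2) (pos : nat -> 'rV[R]_2).
Variables (T0 : seq quad) (F : seq flip).
Hypothesis pile : is_pile pos Rg T0 F.
Local Notation f_ i := (nth flip0 F i).
Local Notation T_ n := (pile_T T0 F n).
Local Notation K_ n := (kverts T0 (take n F)).

Lemma news_not_before n p q : (n < size F)%N -> p \in news (f_ n) ->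
  (q \in T0 \/ exists2 j, (j < n)%N & q \in news (f_ j)) -> ~ qeq p q.
Proof.
move=> nF pn qb pq; have /negP := flip_fresh pile nF; apply.
apply: (face_verts pile (ltnW nF) qb); rewrite -(qeq_mem pq).
exact: news_fv.
Qed.

Lemma news_unique i j p q : (i < size F)%N -> (j < size F)%N ->
  p \in news (f_ i) -> q \in news (f_ j) -> qeq p q -> i = j.
Proof.
move=> iF jF pi qj pq; case: (ltngtP i j) => // h; exfalso.
- by apply: (news_not_before jF qj _ (qeq_sym pq)); right; exists i.
- by apply: (news_not_before iF pi _ pq); right; exists j.
Qed.

(** A face coming back later would contain the fresh vertex of the flip creating it, whereas the
    vertices of [p] are older. *)
Lemma olds_gone i n p q : (i < n)%N -> (n <= size F)%N ->
  p \in olds (f_ i) -> q \in T_ n -> ~ qeq p q.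
Proof.
elim: n q => // n IH q; rewrite ltnS => leq_in nF pi.
have iF : (i < size F)%N by exact: leq_ltn_trans leq_in nF.
rewrite pile_TS // mem_cat => /orP[qn|qn] pq.
  move: qn; rewrite mem_filter => /andP[nold qT].
  move: leq_in; rewrite leq_eqVlt => /orP[/eqP E|ltin]; last exact: (IH q ltin (ltnW nF) pi qT pq).
  move/negP: nold; apply; have qp := qeq_sym pq.
  by move: pi; rewrite E /is_old !inE => /or3P[] /eqP <-; rewrite qp ?orbT.
have /negP := flip_fresh pile nF; apply.
apply: (kverts_take_sub leq_in (ltnW nF)); apply: (olds_verts pile iF pi).
by rewrite (qeq_mem pq); exact: news_fv.
Qed.

Lemma olds_unique i j p q : (i < size F)%N -> (j < size F)%N ->
  p \in olds (f_ i) -> q \in olds (f_ j) -> qeq p q -> i = j.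
Proof.
have H i' j' p' q' : (j' < size F)%N -> (i' < j')%N ->
    p' \in olds (f_ i') -> q' \in olds (f_ j') -> ~ qeq p' q'.
  move=> jF ij pi /(old_in_pile pile jF)[r rT qr] pq.
  exact: (olds_gone ij (ltnW jF) pi rT (qeq_trans pq qr)).
move=> iF jF pi qj pq; case: (ltngtP i j) => // h; exfalso.
- exact: (H _ _ _ _ jF h pi qj pq).
- exact: (H _ _ _ _ iF h qj pi (qeq_sym pq)).
Qed.

Lemma kfaces_uniq_sub q : q \in kfaces T0 F ->
  uniq (qverts q) /\ {subset qverts q <= kverts T0 F}.
Proof.
move=> /mem_kfaces qF; split.
  apply: (@nondegenerate_uniq R pos); case: qF => [qT|[j jF qj]].
    by apply: (pile_nondegenerate pile (leq0n _)); rewrite /pile_T take0.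
  exact: (news_nondegenerate pile jF qj).
by rewrite -[F in kverts T0 F]take_size; exact: (face_verts pile (leqnn _) qF).
Qed.

Lemma cubes_uniq_sub j : (j < size F)%N ->
  uniq (cube_verts (f_ j)) /\ {subset cube_verts (f_ j) <= kverts T0 F}.
Proof.
by move=> jF; split; [exact: cube_verts_uniq pile _ jF|case: (cube_verts_sub pile jF)].
Qed.

Section Vertex.
Variable v : nat.
Hypothesis iv : interior_vertex R T0 F v.

Lemma no_free_face i p : (i < size F)%N -> p \in cube_faces (f_ i) ->
  v \in qverts p ->
  ~ (forall j q, (j < size F)%N -> q \in cube_faces (f_ j) -> qeq p q -> j = i).
Proof.
move=> iF pi vp only.
exact: (free_face_not_interior kfaces_uniq_sub cubes_uniq_sub iF pi vp only iv).
Qed.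

(* In the first cube containing a vertex of [T0], some bottom face at this
   vertex belongs to [T0], hence to no other cube. *)
Lemma interior_notin_T0 m : (m < size F)%N -> v \in cube_verts (f_ m) ->
  v \notin Tverts T0.
Proof.
move=> mF vm; apply/negP => vT.
have ex : exists j, (j < size F)%N && (v \in cube_verts (f_ j)).
  by exists m; rewrite mF.
case: (ex_minnP ex) => i /andP[iF vi] imin.
have vfv : v != fv (f_ i).
  apply: contraTneq vT => ->; apply: contra (flip_fresh pile iF) => h.
  by rewrite mem_cat h.
have [p po vp] : exists2 p, p \in olds (f_ i) & v \in qverts p.
  move: vi; rewrite -mem_rev [rev _]/= in_cons (negPf vfv) /= !inE.
  do ![case/orP]; move/eqP => ->;
  by [exists (old1 (f_ i)); rewrite !inE /qv0 /qv1 /qv2 /qv3 /= eqxx ?orbT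
     |exists (old2 (f_ i)); rewrite !inE /qv0 /qv1 /qv2 /qv3 /= eqxx ?orbT
     |exists (old3 (f_ i)); rewrite !inE /qv0 /qv1 /qv2 /qv3 /= eqxx ?orbT].
have [q0 q0T pq0] := old_in_pile pile iF po.
have q0T0 : q0 \in T0.
  have [//|[j ji q0j]] := mem_pile (ltnW iF) q0T.
  have : (i <= j)%N.
    apply: imin; rewrite (ltn_trans ji iF) /=.
    apply: (@cube_face_sub _ q0); first by rewrite cube_faces_cat mem_cat q0j orbT.
    by rewrite -(qeq_mem pq0).
  by rewrite leqNgt ji.
apply: (@no_free_face i p iF _ vp); first by rewrite cube_faces_cat mem_cat po.
move=> j q jF; rewrite cube_faces_cat mem_cat => /orP[qo|qn] pq.
  exact: (olds_unique jF iF qo po (qeq_sym pq)).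
exfalso; apply: (news_not_before jF qn (or_introl q0T0)).
exact: qeq_trans (qeq_sym pq) pq0.
Qed.

(** Otherwise [p] lies in the cube of flip [j] only, since no other flip creates it, and it is
    free. *)
Lemma interior_news_old j p : (j < size F)%N -> p \in news (f_ j) ->
  v \in qverts p ->
  exists2 i, (i < size F)%N & exists2 q, q \in olds (f_ i) & qeq p q.
Proof.
move=> jF pj vp; apply: contrapT => nold.
apply: (@no_free_face j p jF _ vp); first by rewrite cube_faces_cat mem_cat pj orbT.
move=> i q iF; rewrite cube_faces_cat mem_cat => /orP[qo|qn] pq.
  by case: nold; exists i => //; exists q.
exact: (news_unique iF jF qn pj (qeq_sym pq)).
Qed.

(** The face is present before flip [i] and, as [v] is not in [T0], it was created by an earlier
    flip. *)
Lemma interior_olds_new i p : (i < size F)%N -> p \in olds (f_ i) ->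
  v \in qverts p ->
  exists2 j, (j < size F)%N & exists2 q, q \in news (f_ j) & qeq p q.
Proof.
move=> iF po vp; have [q qT pq] := old_in_pile pile iF po.
have vq : v \in qverts q by rewrite -(qeq_mem pq).
have [qT0|[j ji qj]] := mem_pile (ltnW iF) qT; last first.
  by exists j; [exact: ltn_trans ji iF|exists q].
have pf : p \in cube_faces (f_ i) by rewrite cube_faces_cat mem_cat po.
have /negP[] := interior_notin_T0 iF (cube_face_sub pf vp).
by apply/flattenP; exists (qverts q) => //; exact: map_f.
Qed.

Lemma uniq_canon_news : uniq (map quad_canon (flatten (map news F))).
Proof.
apply: uniq_canon_flatten => [i iF|i j p q ij jF pi qj pq]; last first.
  by have := news_unique (ltn_trans ij jF) jF pi qj pq => E; rewrite E ltnn in ij.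
have [n12 n13 n23] := news_not_qeq (cube_verts_uniq pile iF).
rewrite /= !inE !negb_or andbT -andbA.
by apply/and3P; split; apply/eqP => /quad_canonP.
Qed.

Lemma uniq_canon_olds : uniq (map quad_canon (flatten (map olds F))).
Proof.
apply: uniq_canon_flatten => [i iF|i j p q ij jF pi qj pq]; last first.
  by have := olds_unique (ltn_trans ij jF) jF pi qj pq => E; rewrite E ltnn in ij.
have [n12 n13 n23] := olds_not_qeq (cube_verts_uniq pile iF).
rewrite /= !inE !negb_or andbT -andbA.
by apply/and3P; split; apply/eqP => /quad_canonP.
Qed.

Lemma mem_flatten_flips (G : flip -> seq quad) q : q \in flatten (map G F) <->
  exists2 i, (i < size F)%N & q \in G (f_ i).
Proof.
split=> [/flattenP[s sF qs]|[i iF qi]].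
  have [j jF js] := nthP [::] sF; rewrite size_map in jF.
  by exists j => //; rewrite -(nth_map flip0 [::] G) // js.
apply/flattenP; exists (G (f_ i)) => //.
by apply/(nthP [::]); exists i; rewrite ?size_map // (nth_map flip0).
Qed.

(** Every face at [v] is counted twice, as a new face of one cube and as an old face of another. *)
Lemma prod_interior_faces (A : comPzRingType) (y : quad -> A) m :
  (forall q q', qeq q q' -> y q = y q') ->
  (m < size F)%N -> v \in cube_verts (f_ m) ->
  let Y := \prod_(q <- kfaces T0 F | v \in qverts q) y q in
  \prod_(i < size F) \prod_(q <- cube_faces (f_ i) | v \in qverts q) y q = Y * Y.
Proof.
move=> yq mF vm Y.
have vT := interior_notin_T0 mF vm.
have flat G : \prod_(i < size F) \prod_(q <- G (f_ i) | v \in qverts q) y q =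
    \prod_(q <- flatten (map G F) | v \in qverts q) y q.
  by rewrite big_flatten big_map (big_nth flip0) big_mkord.
have YE : Y = \prod_(q <- flatten (map news F) | v \in qverts q) y q.
  rewrite /Y /kfaces big_cat /= big_seq_cond big1 ?mul1r // => q /andP[qT vq].
  by move/negP: vT; case; apply/flattenP; exists (qverts q) => //; exact: map_f.
(* Old and new listings of a face may differ by a symmetry; after passing to representatives the two
   lists at [v] are permutations of each other. *)
have YO : \prod_(q <- flatten (map olds F) | v \in qverts q) y q = Y.
  have C (s : seq quad) : \prod_(q <- s | v \in qverts q) y q =
      \prod_(q <- map quad_canon [seq q <- s | v \in qverts q]) y q.
    by rewrite big_map big_filter; apply: eq_bigr => q _; exact/yq/qeq_canon.
  rewrite YE !C; apply: perm_big; apply: uniq_perm.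
  - exact: subseq_uniq (map_subseq _ (filter_subseq _ _)) uniq_canon_olds.
  - exact: subseq_uniq (map_subseq _ (filter_subseq _ _)) uniq_canon_news.
  move=> c; apply/idP/idP => /mapP [q];
    rewrite mem_filter => /andP[vq /mem_flatten_flips[i iF qi]] ->.
    have [j jF [q' qj qq']] := interior_olds_new iF qi vq.
    rewrite (quad_canonP _ _ qq') map_f // mem_filter -(qeq_mem qq') vq /=.
    by apply/mem_flatten_flips; exists j.
  have [j jF [q' qj qq']] := interior_news_old iF qi vq.
  rewrite (quad_canonP _ _ qq') map_f // mem_filter -(qeq_mem qq') vq /=.
  by apply/mem_flatten_flips; exists j.
rewrite -{1}YO YE -!flat -big_split /=; apply: eq_bigr => i _.
by rewrite cube_faces_cat big_cat.
Qed.
End Vertex.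
End PileInterior.

Lemma prod_faces_at_cvert (A : comPzRingType) (y : quad -> A) f a b c :
  uniq (cube_verts f) ->
  \prod_(q <- cube_faces f | cvert f a b c \in qverts q) y q =
  (if a then y (new3 f) else y (old2 f)) * (if b then y (new1 f) else y (old3 f))
  * (if c then y (new2 f) else y (old1 f)).
Proof.
move=> U.
have E a1 b1 c1 a2 b2 c2 : (cvert f a1 b1 c1 == cvert f a2 b2 c2) = ((a1, b1, c1) == (a2, b2, c2)).
  exact: (inj_eq (cvert_inj U) (a1, b1, c1) (a2, b2, c2)).
have m1 : (cvert f a b c \in qverts (old1 f)) = ~~ c.
  have -> : qverts (old1 f) = [:: cvert f false false false; cvert f true false false;
    cvert f true true false; cvert f false true false] by [].
  by rewrite !inE !E; clear; case: a b c => [] [] [].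
have m2 : (cvert f a b c \in qverts (old2 f)) = ~~ a.
  have -> : qverts (old2 f) = [:: cvert f false false false; cvert f false true false;
    cvert f false true true; cvert f false false true] by [].
  by rewrite !inE !E; clear; case: a b c => [] [] [].
have m3 : (cvert f a b c \in qverts (old3 f)) = ~~ b.
  have -> : qverts (old3 f) = [:: cvert f false false false; cvert f false false true;
    cvert f true false true; cvert f true false false] by [].
  by rewrite !inE !E; clear; case: a b c => [] [] [].
have n1 : (cvert f a b c \in qverts (new1 f)) = b.
  have -> : qverts (new1 f) = [:: cvert f true true true; cvert f true true false;
    cvert f false true false; cvert f false true true] by [].
  by rewrite !inE !E; clear; case: a b c => [] [] [].
have n2 : (cvert f a b c \in qverts (new2 f)) = c.
  have -> : qverts (new2 f) = [:: cvert f true true true; cvert f false true true;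
    cvert f false false true; cvert f true false true] by [].
  by rewrite !inE !E; clear; case: a b c => [] [] [].
have n3 : (cvert f a b c \in qverts (new3 f)) = a.
  have -> : qverts (new3 f) = [:: cvert f true true true; cvert f true false true;
    cvert f true false false; cvert f true true false] by [].
  by rewrite !inE !E; clear; case: a b c => [] [] [].
rewrite !big_cons big_nil m1 m2 m3 n1 n2 n3.
by clear; case: a b c => [] [] [] /=; ring.
Qed.

Definition cube_sign (A : pzRingType) (f : flip) (v : nat) : A :=
  if (v == fw f) || (v == fv f) then 1 else -1.

(** * Top and bottom cubes of an interior vertex *)

Section Sign.
Variables (R : realType) (Rg : set 'rV[R]_2) (pos : nat -> 'rV[R]_2).
Variables (T0 : seq quad) (F : seq flip).
Hypothesis pile : is_pile pos Rg T0 F.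
Local Notation f_ i := (nth flip0 F i).
Local Notation T_ n := (pile_T T0 F n).
Local Notation K_ n := (kverts T0 (take n F)).

(** The six hexagon vertices survive on the new faces, so only the bottom vertex can disappear. *)
Lemma vertex_lost n v q : (n < size F)%N -> q \in T_ n -> v \in qverts q ->
  v \notin Tverts (T_ n.+1) -> v = fw (f_ n).
Proof.
move=> nF qT vq nv.
have out p : p \in T_ n.+1 -> v \notin qverts p.
  by move=> pT; apply: contra nv => vp; apply/flattenP; exists (qverts p) => //; exact: map_f.
have qold : is_old (f_ n) q.
  by apply: contraLR vq => nold; apply: out; rewrite pile_TS // mem_cat mem_filter nold qT.
have o1 : v \notin qverts (new1 (f_ n)).
  by apply/out/news_in_pile => //; rewrite !inE eqxx ?orbT.
have o2 : v \notin qverts (new2 (f_ n)).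
  by apply/out/news_in_pile => //; rewrite !inE eqxx ?orbT.
have o3 : v \notin qverts (new3 (f_ n)).
  by apply/out/news_in_pile => //; rewrite !inE eqxx ?orbT.
move: o1 o2 o3; rewrite !inE /qv0 /qv1 /qv2 /qv3 /= !negb_or.
move=> /and4P[_ /negPf b1 /negPf b2 /negPf b3]
  /and4P[_ _ /negPf b4 /negPf b5] /and4P[_ _ /negPf b6 _].
move: qold vq; rewrite /is_old => /or3P[] /qeq_mem ->;
  rewrite !inE /qv0 /qv1 /qv2 /qv3 /= ?b1 ?b2 ?b3 ?b4 ?b5 ?b6 ?orbF; exact: eqP.
Qed.

(** Validity of a flip makes all faces at its bottom vertex old, so this vertex disappears at once.
    It never returns, since vertices of later faces are present before their flip or fresh. *)
Lemma fw_removed i n : (i < n)%N -> (n <= size F)%N -> fw (f_ i) \notin Tverts (T_ n).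
Proof.
elim: n => // n IH; rewrite ltnS => leq_in nF.
have iF : (i < size F)%N by exact: leq_ltn_trans leq_in nF.
apply/negP => /flattenP[s /mapP[q qT ->] vq].
have wK : fw (f_ i) \in K_ i.
  by apply: (olds_verts pile iF (p := old1 (f_ i))); rewrite !inE eqxx.
have wfv : fw (f_ i) != fv (f_ n).
  apply: contraNneq (flip_fresh pile nF) => <-.
  exact: (kverts_take_sub leq_in (ltnW nF)).
have keep p : p \in T_ n -> ~~ is_old (f_ n) p -> fw (f_ i) \in qverts p -> False.
  move=> pT nold vp; move: leq_in; rewrite leq_eqVlt => /orP[/eqP E|ltin].
    case: pile => _ _ /(_ n nF)[_ _ _ H _].
    by move: nold; rewrite H // -E.
  have /negP := IH ltin (ltnW nF); apply.
  by apply/flattenP; exists (qverts p) => //; exact: map_f.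
move: qT; rewrite pile_TS // mem_cat => /orP[|qn].
  by rewrite mem_filter => /andP[nold qT]; exact: keep qT nold vq.
have [/eqP|[p po vp]] := hexagon_in_olds qn vq; first by rewrite (negPf wfv).
move: leq_in; rewrite leq_eqVlt => /orP[/eqP E|ltin]; last first.
  have [p' p'T pp'] := old_in_pile pile nF po.
  have /negP := IH ltin (ltnW nF); apply.
  by apply/flattenP; exists (qverts p'); rewrite -?(qeq_mem pp') //; exact: map_f.
have U := cube_verts_uniq pile nF; rewrite -E in qn U nF.
move: qn vq; rewrite !inE => /or3P[] /eqP ->; rewrite /qv0 /qv1 /qv2 /qv3 /=;
  move=> /or4P[] /eqP W; move: U;
  by rewrite /cube_verts W /= !inE !eqxx ?orbT ?andbF.
Qed.

Lemma fw_unique i j : (i < size F)%N -> (j < size F)%N -> fw (f_ i) = fw (f_ j) -> i = j.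
Proof.
have H i' j' : (i' < j')%N -> (j' < size F)%N -> fw (f_ i') <> fw (f_ j').
  move=> ij jF E; have /negP := fw_removed ij (ltnW jF); apply; rewrite E.
  have [q qT pq] := old_in_pile pile jF (p := old1 (f_ j')) ltac:(by rewrite !inE eqxx).
  apply/flattenP; exists (qverts q); first exact: map_f.
  by rewrite -(qeq_mem pq) !inE eqxx.
move=> iF jF E; case: (ltngtP i j) => // h; exfalso.
- exact: H h jF E.
- exact: H h iF (esym E).
Qed.

Lemma fv_unique i j : (i < size F)%N -> (j < size F)%N -> fv (f_ i) = fv (f_ j) -> i = j.
Proof.
have H i' j' : (i' < j')%N -> (j' < size F)%N -> fv (f_ i') <> fv (f_ j').
  move=> ij jF E; have /negP := flip_fresh pile jF; apply.
  by rewrite -E; apply/(mem_kverts_take _ _ (ltnW jF)); right; exists i'.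
move=> iF jF E; case: (ltngtP i j) => // h; exfalso.
- exact: H h jF E.
- exact: H h iF (esym E).
Qed.

(** Not being in [T0], the vertex was created by a flip. If it were never a bottom, it would lie on
    a face of the last quadrangulation; but faces at [v] are old faces of some flip, hence
    removed. *)
Lemma interior_top_bottom v m : interior_vertex R T0 F v ->
  (m < size F)%N -> v \in cube_verts (f_ m) ->
  (exists2 i, (i < size F)%N & v = fw (f_ i)) /\
  (exists2 i, (i < size F)%N & v = fv (f_ i)).
Proof.
move=> iv mF vm.
have vT := interior_notin_T0 pile iv mF vm.
have [j jF vE] : exists2 i, (i < size F)%N & v = fv (f_ i).
  have [vK _] := iv; have := vK; rewrite -[F in kverts T0 F]take_size.
  by move/(mem_kverts_take _ _ (leqnn _)) => [vin|//]; rewrite vin in vT.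
split; last by exists j.
apply: contrapT => nw.
have alive n : (j < n)%N -> (n <= size F)%N -> v \in Tverts (T_ n).
  elim: n => // n IH; rewrite ltnS leq_eqVlt => /orP[/eqP<-|jn] nF.
    apply/flattenP; exists (qverts (new1 (f_ j))).
      by apply: map_f; apply: news_in_pile => //; rewrite !inE eqxx.
    by rewrite !inE vE eqxx.
  have /flattenP[s /mapP[q qT ->] vq] := IH jn (ltnW nF).
  apply: contraT => /(vertex_lost nF qT vq) E.
  by case: nw; exists n.
have /flattenP[s /mapP[q qT ->] vq] := alive _ jF (leqnn _).
have [qT0|[k kF qk]] := mem_pile (leqnn _) qT.
  by move/negP: vT; apply; apply/flattenP; exists (qverts q) => //; exact: map_f.
have [i iF [p po qp]] := interior_news_old pile iv kF qk vq.
exact: (olds_gone pile iF (leqnn _) po qT (qeq_sym qp)).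
Qed.

(* Counting faces at [v] by cubes shows that the number of cubes at [v] is even;
   exactly one of them has [v] as its bottom and exactly one as its top. *)
Lemma prod_cube_sign (A : comPzRingType) v : interior_vertex R T0 F v ->
  \prod_(i < size F | v \in cube_verts (f_ i)) cube_sign A (f_ i) v = 1.
Proof.
move=> iv.
have [[m vm]|none] := pselect (exists m : 'I_(size F), v \in cube_verts (f_ m)); last first.
  by apply: big_pred0 => i; apply/negP => vi; apply: none; exists i.
have [[i iF vi] [j jF vj]] := interior_top_bottom iv (ltn_ord m) vm.
(* The face count with all values -1: each cube at [v] contributes (-1)^3, and the total is a square
   equal to 1. *)
have even : \prod_(k < size F | v \in cube_verts (f_ k)) (-1) = 1 :> A.
  have := prod_interior_faces pile iv (y := fun=> -1 : A) (fun _ _ _ => erefl) (ltn_ord m) vm.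
  rewrite (bigID (fun i : 'I_(size F) => v \in cube_verts (f_ i))) /=
    [X in _ * X]big1 ?mulr1; last first.
    move=> k nvk; rewrite big_seq_cond big1 // => q /andP[qk vq].
    by move: nvk; rewrite (cube_face_sub qk vq).
  rewrite -big_split /= [RHS]big1; last by move=> q _; rewrite mulrNN mulr1.
  move=> H; rewrite -[RHS]H; apply: eq_bigr => k /cube_verts_cvert[a [b [c ->]]].
  rewrite prod_faces_at_cvert ?(cube_verts_uniq pile) //.
  by case: a b c => [] [] []; ring.
have single (g : flip -> nat) k (kF : (k < size F)%N) : v = g (f_ k) -> v \in cube_verts (f_ k) ->
    (forall l, (l < size F)%N -> g (f_ l) = g (f_ k) -> l = k) ->
    \prod_(l < size F | v \in cube_verts (f_ l)) (if v == g (f_ l) then -1 else 1) = -1 :> A.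
  move=> vk vin uk; rewrite (bigD1 (Ordinal kF)) //= {1}vk eqxx big1 ?mulr1 // => l /andP[_ lk].
  case: eqP => // E; move/eqP: lk; case; apply: val_inj => /=.
  by apply: uk; rewrite // -E vk.
have bot := single fw i iF vi ltac:(by rewrite vi inE eqxx) (fun l lF => fw_unique lF iF).
have top := single fv j jF vj ltac:(by rewrite vj !inE eqxx !orbT) (fun l lF => fv_unique lF jF).
(* The sign is -1, times -1 at a bottom, times -1 at a top; the three resulting products are 1, -1
   and -1. *)
transitivity (\prod_(l < size F | v \in cube_verts (f_ l))
   ((-1) * ((if v == fw (f_ l) then -1 else 1) * (if v == fv (f_ l) then -1 else 1))) : A).
  apply: eq_bigr => l _; rewrite /cube_sign.
  have := cube_verts_uniq pile (ltn_ord l).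
  case: (v =P fw _) => [->|_]; case: (_ =P fv _) => [E|_] /=;
    rewrite ?mulr1 ?mul1r ?mulrNN ?mulr1 //.
  by rewrite -E !inE eqxx ?orbT.
by rewrite !big_split /= even bot top mul1r mulrNN mulr1.
Qed.
End Sign.

(** * Signed K-hexahedron equations *)

Section Algebra.
Variable K : fieldType.
Hypothesis two_neq0 : (2 : K) != 0.

Definition hexa_A (z : bool -> bool -> bool -> K) : K :=
  2 * z true false false * z false true false * z false false true
  + z false false false * (z true false false * z false true true
    + z false true false * z true false true + z false false true * z true true false).

Variables (z : bool -> bool -> bool -> K) (A B C : K).
Hypothesis z0 : z false false false != 0.
Hypothesis hA : A ^+ 2 = z false false false * z false true true
                         + z false true false * z false false true.
Hypothesis hB : B ^+ 2 = z false false false * z true false true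
                         + z false false true * z true false false.
Hypothesis hC : C ^+ 2 = z false false false * z true true false
                         + z true false false * z false true false.

(* As a quadratic polynomial in the value at the top vertex, [Kcube] has
   discriminant [(4 A B C)^2]. *)
Lemma kashaev_sign : Kcube z = 0 -> exists2 e : int, e = 1 \/ e = -1 &
  z true true true = (hexa_A z + 2 * e%:~R * (A * B * C)) / z false false false ^+ 2.
Proof.
(* [D] completes the square in the top value; [Kcube] has leading coefficient
   [z false false false ^+ 2] in it. *)
move=> K0; pose D := z false false false ^+ 2 * z true true true - hexa_A z.
have : D ^+ 2 = (2 * (A * B * C)) ^+ 2.
  have -> : D ^+ 2 = z false false false ^+ 2 * Kcube z
    + 4 * (z false false false * z false true true + z false true false * z false false true)
      * (z false false false * z true false true + z false false true * z true false false)
      * (z false false false * z true true false + z true false false * z false true false).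
    by rewrite /D /hexa_A /Kcube; ring.
  by rewrite K0 -hA -hB -hC; ring.
have zE : z true true true = (hexa_A z + D) / z false false false ^+ 2.
  by rewrite /D; field.
move/eqP; rewrite eqf_sqr => /orP[] /eqP DE; rewrite zE DE.
  by exists 1; [left|rewrite mulr1].
by exists (-1); [right|rewrite mulrN1 mulNr].
Qed.

(** The new face values are again square roots of the face terms, so the construction can continue
    upwards, and all eight [Kvert] factor over the faces. *)
Lemma kashaev_vertices (u : K) : u = 1 \/ u = -1 ->
  z true true true = (hexa_A z + 2 * u * (A * B * C)) / z false false false ^+ 2 ->
  let A' := (u * (B * C) + A * z true false false) / z false false false in
  let B' := (u * (A * C) + B * z false true false) / z false false false in
  let C' := (u * (A * B) + C * z false false true) / z false false false in
  [/\ A' ^+ 2 = z true true true * z true false false + z true false true * z true true false,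
      B' ^+ 2 = z true true true * z false true false + z true true false * z false true true &
      C' ^+ 2 = z true true true * z false false true + z false true true * z true false true] /\
  forall a b c, Kvert z a b c =
    (if (a == b) && (b == c) then 1 else -1) * u
      * ((if a then A' else A) * (if b then B' else B) * (if c then C' else C)).
Proof.
move=> u1 zt A' B' C'.
(* Eliminating these three vertices leaves rational identities in independent variables, up to [u] =
   1 or -1. *)
have zA : z false true true =
    (A ^+ 2 - z false true false * z false false true) / z false false false.
  by rewrite hA; field.
have zB : z true false true =
    (B ^+ 2 - z false false true * z true false false) / z false false false.
  by rewrite hB; field.
have zC : z true true false =
    (C ^+ 2 - z true false false * z false true false) / z false false false.
  by rewrite hC; field.
rewrite /hexa_A in zt; rewrite /Kvert /A' /B' /C'.
split.
  split; rewrite zt zA zB zC; case: u1 => ->; field; exact: z0.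
by move=> [] [] [] /=; rewrite zt zA zB zC; case: u1 => ->; field; rewrite ?z0 ?two_neq0.
Qed.
End Algebra.

Lemma fterm_qeq (K : fieldType) (x : nat -> K) q q' : qeq q q' -> fterm x q = fterm x q'.
Proof.
case: q => [[[a b] c] d]; rewrite /qeq !inE; do ![case/orP]; move/eqP => ->;
  rewrite /fterm /qrot /qrev /qv0 /qv1 /qv2 /qv3 /=; ring.
Qed.

Lemma Kv_cvert (K : fieldType) (x : nat -> K) f a b c : uniq (cube_verts f) ->
  Kv f x (cvert f a b c) = Kvert (zf f x) a b c.
Proof.
move=> U; rewrite /Kv; case: pickP => [e /eqP E|/(_ (a, b, c))]; last by rewrite /= eqxx.
by rewrite (cvert_inj U (x1 := e) (x2 := (a, b, c)) E).
Qed.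

(* The K-hexahedron equations of a cube, up to the sign [u] of the product of
   the three bottom faces. *)
Definition signed_hexahedron (K : fieldType) (x : nat -> K) (y : quad -> K) (f : flip) (u : K) :=
  let z := zf f x in
  [/\ y (new3 f) = (u * (y (old3 f) * y (old1 f)) + y (old2 f) * z true false false)
        / z false false false,
      y (new1 f) = (u * (y (old2 f) * y (old1 f)) + y (old3 f) * z false true false)
        / z false false false,
      y (new2 f) = (u * (y (old2 f) * y (old3 f)) + y (old1 f) * z false false true)
        / z false false false &
      z true true true = (hexa_A z + 2 * u * (y (old2 f) * y (old3 f) * y (old1 f)))
                         / z false false false ^+ 2].

(** * Signed solutions along a pile *)

Section Propagation.
Variables (R : realType) (Rg : set 'rV[R]_2) (pos : nat -> 'rV[R]_2).
Variables (T0 : seq quad) (F : seq flip).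
Hypothesis pile : is_pile pos Rg T0 F.
Variable x : nat -> R[i].
Hypothesis x_neq0 : forall v, v \in kverts T0 F -> x v != 0.
Hypothesis Kcube0 : forall i, (i < size F)%N -> Kcube (zf (nth flip0 F i) x) = 0.
Local Notation f_ i := (nth flip0 F i).

Let two_neq0 : (2 : R[i]) != 0. Proof. by rewrite pnatr_eq0. Qed.

Lemma bottom_neq0 i : (i < size F)%N -> x (fw (f_ i)) != 0.
Proof.
by move=> iF; apply: x_neq0; case: (cube_verts_sub pile iF) => _; apply; rewrite inE eqxx.
Qed.

(** Induction on the flips: the bottom faces already carry square roots, [kashaev_sign] provides the
    sign, and [kashaev_vertices] the square roots on the new faces. *)
Lemma signed_hexahedron_exists n : (n <= size F)%N ->
  exists (y : quad -> R[i]) (u : nat -> int),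
  [/\ forall q q', qeq q q' -> y q = y q',
      forall q, (q \in T0 \/ exists2 j, (j < n)%N & q \in news (f_ j)) -> y q ^+ 2 = fterm x q,
      forall i, (i < n)%N -> u i = 1 \/ u i = -1 &
      forall i, (i < n)%N -> signed_hexahedron x y (f_ i) (u i)%:~R].
Proof.
elim: n => [|n IH] nF.
  exists (fun q => sqrtC (fterm x q)), (fun=> 1); split => // [q q' qq'|q _].
    by rewrite (fterm_qeq _ qq').
  exact: sqrtCK.
have [y [u [yq ysq us hex]]] := IH (ltnW nF).
set f := f_ n.
have yold p : p \in olds f -> y p ^+ 2 = fterm x p.
  move=> po; have [q qT pq] := old_in_pile pile nF po.
  by rewrite (yq _ _ pq) (fterm_qeq _ pq) ysq //; exact: mem_pile (ltnW nF) qT.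
have in1 : old1 f \in olds f by rewrite !inE eqxx.
have in2 : old2 f \in olds f by rewrite !inE eqxx orbT.
have in3 : old3 f \in olds f by rewrite !inE eqxx !orbT.
have z0 : zf f x false false false != 0 by exact: bottom_neq0.
have [e e1 zt] := kashaev_sign z0 (yold _ in2) (yold _ in3) (yold _ in1) (Kcube0 nF).
have e1' : (e%:~R : R[i]) = 1 \/ (e%:~R : R[i]) = -1 by case: e1 => ->; [left|right].
have [[sA sB sC] _] := kashaev_vertices two_neq0 z0 (yold _ in2) (yold _ in3) (yold _ in1) e1' zt.
set A' := (_ + y (old2 f) * _) / _ in sA.
set B' := (_ + y (old3 f) * _) / _ in sB.
set C' := (_ + y (old1 f) * _) / _ in sC.
(* Faces are compared by [qeq], which keeps the values independent of the listing. *)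
pose y' q := if qeq q (new1 f) then B' else if qeq q (new2 f) then C'
             else if qeq q (new3 f) then A' else y q.
have y'q q q' : qeq q q' -> y' q = y' q'.
  move=> qq'; rewrite /y' (yq _ _ qq').
  have E p : qeq q p = qeq q' p.
    by apply/idP/idP; apply: qeq_trans; [exact: qeq_sym|].
  by rewrite !E.
have y'old q : (q \in T0 \/ exists2 j, (j < n)%N & q \in news (f_ j)) -> y' q = y q.
  move=> qb; have N p : p \in news f -> qeq q p = false.
    by move=> pn; apply/negP => /qeq_sym; exact: (news_not_before pile nF pn qb).
  by rewrite /y' !N // !inE eqxx ?orbT.
(* Bottom faces of all cubes so far, that of flip [n] included, existed before flip [n] and keep
   their values. *)
have y'olds i p : (i <= n)%N -> p \in olds (f_ i) -> y' p = y p.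
  move=> leq_in po; have iF : (i < size F)%N by exact: leq_ltn_trans leq_in nF.
  have [q qT pq] := old_in_pile pile iF po.
  rewrite (y'q _ _ pq) (yq _ _ pq) y'old //.
  have [|[j ji qj]] := mem_pile (ltnW iF) qT; first by left.
  by right; exists j => //; exact: leq_trans ji leq_in.
have [n12 n13 n23] := news_not_qeq (cube_verts_uniq pile nF).
have y1 : y' (new1 f) = B' by rewrite /y' qeq_refl.
have y2 : y' (new2 f) = C'.
  by rewrite /y' qeq_refl; case: ifP => // /qeq_sym.
have y3 : y' (new3 f) = A'.
  by rewrite /y' qeq_refl; case: ifP => [/qeq_sym//|_]; case: ifP => [/qeq_sym//|].
exists y', (fun i => if i == n then e else u i); split => //.
- move=> q [qT|[j]]; first by rewrite y'old ?ysq //; left.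
  rewrite ltnS leq_eqVlt => /orP[/eqP->|jn] qj; last first.
    have qb : q \in T0 \/ exists2 j, (j < n)%N & q \in news (f_ j) by right; exists j.
    by rewrite y'old ?ysq.
  move: qj; rewrite -/f !inE => /or3P[] /eqP ->.
  + by rewrite y1 sB.
  + by rewrite y2 sC.
  + by rewrite y3 sA.
- by move=> i; case: eqP => // ne; rewrite ltnS leq_eqVlt => /orP[/eqP//|]; exact: us.
- move=> i; rewrite ltnS leq_eqVlt => /orP[/eqP->|ltin].
    have O p := y'olds n p (leqnn n).
    by rewrite eqxx -/f /signed_hexahedron y1 y2 y3 (O _ in1) (O _ in2) (O _ in3).
  rewrite (ltn_eqF ltin); have [h1 h2 h3 h4] := hex i ltin.
  have m1 : old1 (f_ i) \in olds (f_ i) by rewrite !inE eqxx.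
  have m2 : old2 (f_ i) \in olds (f_ i) by rewrite !inE eqxx orbT.
  have m3 : old3 (f_ i) \in olds (f_ i) by rewrite !inE eqxx !orbT.
  have N p : p \in news (f_ i) -> y' p = y p.
    by move=> pn; apply: y'old; right; exists i.
  have k1 := N (new1 (f_ i)) ltac:(by rewrite !inE eqxx).
  have k2 := N (new2 (f_ i)) ltac:(by rewrite !inE eqxx orbT).
  have k3 := N (new3 (f_ i)) ltac:(by rewrite !inE eqxx !orbT).
  have O p := y'olds i p (ltnW ltin).
  by rewrite /signed_hexahedron k1 k2 k3 (O _ m1) (O _ m2) (O _ m3).
Qed.

(** * Coherence and the product of the signs at an interior vertex *)

Section Coherent.
Variables (y : quad -> R[i]) (u : nat -> int).
Hypothesis yq : forall q q', qeq q q' -> y q = y q'.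
Hypothesis ysq : forall q, q \in kfaces T0 F -> y q ^+ 2 = fterm x q.
Hypothesis us : forall i, (i < size F)%N -> u i = 1 \/ u i = -1.
Hypothesis hex : forall i, (i < size F)%N -> signed_hexahedron x y (f_ i) (u i)%:~R.
Hypothesis fterm_neq0 : forall q, q \in kfaces T0 F -> fterm x q != 0.

Lemma olds_sqr i p : (i < size F)%N -> p \in olds (f_ i) -> y p ^+ 2 = fterm x p.
Proof.
move=> iF po; have [q qT pq] := old_in_pile pile iF po.
rewrite (yq pq) (fterm_qeq _ pq) ysq //; apply/mem_kfaces.
have [|[j ji qj]] := mem_pile (ltnW iF) qT; first by left.
by right; exists j => //; exact: ltn_trans ji iF.
Qed.

Lemma Kv_prod_faces i v : (i < size F)%N -> v \in cube_verts (f_ i) ->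
  Kv (f_ i) x v = cube_sign R[i] (f_ i) v * (u i)%:~R
    * \prod_(q <- cube_faces (f_ i) | v \in qverts q) y q.
Proof.
move=> iF /cube_verts_cvert[a [b [c ->]]].
have U := cube_verts_uniq pile iF.
rewrite Kv_cvert // prod_faces_at_cvert //.
have [h1 h2 h3 h4] := hex iF.
have m1 := olds_sqr iF (p := old1 (f_ i)) ltac:(by rewrite !inE eqxx).
have m2 := olds_sqr iF (p := old2 (f_ i)) ltac:(by rewrite !inE eqxx orbT).
have m3 := olds_sqr iF (p := old3 (f_ i)) ltac:(by rewrite !inE eqxx !orbT).
have e1 : ((u i)%:~R : R[i]) = 1 \/ ((u i)%:~R : R[i]) = -1 by case: (us iF) => ->; [left|right].
have [_ ->] := kashaev_vertices two_neq0 (bottom_neq0 iF) m2 m3 m1 e1 h4.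
rewrite h1 h2 h3; congr (_ * _ * _).
have E e := inj_eq (cvert_inj U) (a, b, c) e.
rewrite /cube_sign (E (false, false, false)) (E (true, true, true)).
by clear; case: a b c => [] [] [].
Qed.

(** With [Y] the product of [y] over the faces at [v], the product of the [Kv] is the product of the
    [u i] times [Y] squared, while coherence makes it [Y] squared. *)
Lemma interior_prod_sign v : interior_vertex R T0 F v ->
  \prod_(i < size F | v \in cube_verts (f_ i)) Kv (f_ i) x v
    = \prod_(q <- kfaces T0 F | v \in qverts q) fterm x q ->
  \prod_(i < size F | v \in cube_verts (f_ i)) u i = 1.
Proof.
move=> iv coh.
have [[m vm]|none] := pselect (exists m : 'I_(size F), v \in cube_verts (f_ m)); last first.
  by apply: big_pred0 => i; apply/negP => vi; apply: none; exists i.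
have := prod_interior_faces pile iv yq (ltn_ord m) vm.
rewrite (bigID (fun i : 'I_(size F) => v \in cube_verts (f_ i))) /=
    [X in _ * X]big1 ?mulr1; last first.
  move=> i nvi; rewrite big_seq_cond big1 // => q /andP[qi vq].
  by move: nvi; rewrite (cube_face_sub qi vq).
set Y := \prod_(q <- kfaces T0 F | _) _ => YE.
(* Nonvanishing face terms allow the cancellation of [Y]. *)
have Y0 : Y != 0.
  rewrite /Y prodf_seq_neq0; apply/allP => q qF; apply/implyP => _.
  by have := fterm_neq0 qF; rewrite -ysq // sqrf_eq0.
have : (\prod_(i < size F | v \in cube_verts (f_ i)) u i)%:~R * (Y * Y) = Y * Y :> R[i].
  rewrite -[in LHS]YE rmorph_prod -[LHS]mul1r
    -[X in X * _ = _](prod_cube_sign pile R[i] iv) -!big_split /=.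
  transitivity (\prod_(q <- kfaces T0 F | v \in qverts q) fterm x q).
    by rewrite -coh; apply: eq_bigr => i vi; rewrite Kv_prod_faces // mulrA.
  rewrite big_seq_cond [RHS]big_seq_cond.
  by apply: eq_bigr => q /andP[qF _]; rewrite -ysq // expr2.
move=> E; apply/eqP; rewrite -(eqr_int (R[i] : numDomainType)); apply/eqP.
by apply: (mulIf (mulf_neq0 Y0 Y0)); rewrite mul1r.
Qed.
End Coherent.
End Propagation.

(** * Removing the signs by comfortableness *)

Theorem theorem8p10 (R : realType) (Rg : set 'rV[R]_2) (pos : nat -> 'rV[R]_2)
    (T0 : seq quad) (F : seq flip) :
  is_pile pos Rg T0 F ->
  comfortable R T0 F ->
  forall x : nat -> R[i],
    (forall v, v \in kverts T0 F -> x v != 0) ->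
    (forall q, q \in kfaces T0 F -> fterm x q != 0) ->
    coherent R T0 F x ->
    exists y : quad -> R[i],
      (forall q q', qeq q q' -> y q = y q') /\ K_hexahedron T0 F x y.
Proof.
move=> pile comf x x0 ft0 [K0 coh].
have [y [u [yq ysq us hex]]] := signed_hexahedron_exists pile x0 K0 (leqnn _).
have ysq' q : q \in kfaces T0 F -> y q ^+ 2 = fterm x q.
  by move=> /mem_kfaces; exact: ysq.
have [t [t1 tsim tu]] := comf u us
  (fun v iv => interior_prod_sign pile x0 yq ysq' us hex ft0 iv (coh v iv)).
have tq q q' : qeq q q' -> t q = t q'.
  by move=> qq'; apply: tsim; apply: Relation_Operators.rst_step; left.
(* Rescaling by [t] keeps the squares and absorbs [u], which is the product of [t] over the bottom
   faces. *)
exists (fun q => (t q)%:~R * y q); split.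
  by move=> q q' qq'; rewrite (tq _ _ qq') (yq _ _ qq').
split=> [q qF|i iF f z D].
  by rewrite exprMn ysq' //; case: (t1 q qF) => ->; rewrite ?mulrN1z ?expr1n ?sqrrN ?expr1n mul1r.
(* The values of [t] are controlled on [kfaces], where an old face may be listed in another
   order. *)
have told p : p \in olds f -> ((t p)%:~R : R[i]) = 1 \/ ((t p)%:~R : R[i]) = -1.
  move=> po; have [q qT pq] := old_in_pile pile iF po.
  have qF : q \in kfaces T0 F.
    apply/mem_kfaces; have [|[j ji qj]] := mem_pile (ltnW iF) qT; first by left.
    by right; exists j => //; exact: ltn_trans ji iF.
  by rewrite (tq _ _ pq); case: (t1 q qF) => ->; [left|right].
have s1 := told (old1 f) ltac:(by rewrite !inE eqxx).
have s2 := told (old2 f) ltac:(by rewrite !inE eqxx orbT).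
have s3 := told (old3 f) ltac:(by rewrite !inE eqxx !orbT).
have opp q q' : opp_faces F q q' -> t q' = t q.
  by move=> o; apply/esym/tsim/Relation_Operators.rst_step; right.
have t3 : t (new3 f) = t (old2 f) by apply: opp; exists i => //=; rewrite !qeq_refl.
have t1' : t (new1 f) = t (old3 f) by apply: opp; exists i => //=; rewrite !qeq_refl ?orbT.
have t2 : t (new2 f) = t (old1 f) by apply: opp; exists i => //=; rewrite !qeq_refl ?orbT.
have [h1 h2 h3 h4] := hex i iF.
rewrite /hexa_A -/f -/z -/D in h1 h2 h3 h4.
rewrite t1' t2 t3 h1 h2 h3 h4 (tu i iF) -/f !intrM.
(* As opposite faces share their sign and [u i] is now [a * b * c], each equation reduces to a
   square of a sign being 1. *)
move: s1 s2 s3; move: (t (old1 f))%:~R (t (old2 f))%:~R (t (old3 f))%:~R => a b c.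
case=> ->; case=> ->; case=> ->; split; rewrite ?mulN1r ?mul1r; ring.
Qed.
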